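(* Let $e_1,\dots,e_n$ and $e'_1,\dots,e'_n$ be minimal vectors of a lattice in an $n$-dimensional Euclidean space $E$ such that $\{e_i,e'_j\}$ has rank $n$, $(e_1,\dots,e_n)$ is linearly independent, and there is a perfection relation $\sum_{i=1}^n\lambda_i\,p_{e_i}=\sum_{i=1}^n\lambda'_i\,p_{e'_i}$ with strictly positive real coefficients. Let $\Lambda_0$ be the lattice generated by the $e_i$ and $\Lambda$ the lattice generated by all the $e_i,e'_j$. Assume $\Lambda/\Lambda_0$ is cyclic of order $4$. Then $n=7$ or $n=8$, and, after renumbering and negating some of the $e_i$ (and renumbering the $e'_j$), the perfection relation is one of the following three relations, where $e=\frac{e_1+\dots+e_{m_1}+2(e_{m_1+1}+\dots+e_n)}4$ generates $\Lambda$ over $\Lambda_0$: (a) $n=7$, $m_1=4$: with $f=\frac{e_1+e_2+e_3+e_4}2$, $e'_1=e$, $e'_2=e-e_6-e_7$, $e'_3=e-e_5-e_7$, $e'_4=e-e_5-e_6$, $e'_5=f-e_3-e_4$, $e'_6=f-e_2-e_4$, $e'_7=f-e_2-e_3$, the relation $\sum_{i=1}^7p_{e_i}=\sum_{i=1}^7p_{e'_i}$; (b) $n=7$, $m_1=6$: with $e'_j=e-e_j$, the relation $p_{e_1}+\dots+p_{e_6}+2p_{e_7}=p_{e'_1}+\dots+p_{e'_6}+2p_{e'_7}$; (c) $n=8$, $m_1=8$: with $e'_j=e-e_j$, the relation $\sum_{j=1}^8p_{e_j}=\sum_{j=1}^8p_{e'_j}$.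
   Context: For a nonzero vector $x$ of a Euclidean space, $p_x$ denotes the orthogonal projection onto $\mathbb{R}x$. A minimal vector of a lattice is a nonzero lattice vector of minimal norm. Relations are considered up to multiplication by a positive scalar.
   Formalization: The perfection relation is taken with no projection p_{e_i} equal to any p_{e'_j}; without this the claim fails (add an orthogonal e_8 = e'_8 of the same norm to relation (b)). The e'_j are identified up to sign. *)

(* Defs.v *)
From HB Require Import structures.
From mathcomp Require Import all_boot all_order all_fingroup all_algebra.
From mathcomp Require Import sesquilinear reals.

Set Implicit Arguments.
Unset Strict Implicit.
Unset Printing Implicit Defensive.

Import Order.TTheory GRing.Theory Num.Theory.
Local Open Scope ring_scope.

Section Lattices.
Variables (R : realType) (E : vectType R) (dot : {dot E for idfun}).

Definition is_lattice (L : E -> Prop) : Prop :=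
  exists2 b : (\dim {:E}).-tuple E, free b & forall v, L v <-> inIntSpan b v.

Definition minimal_vector (L : E -> Prop) (x : E) : Prop :=
  [/\ L x, x != 0 & forall y, L y -> y != 0 -> dot x x <= dot y y].

(* L = L0 + Z g *)
Definition gen_over (L L0 : E -> Prop) (g : E) : Prop :=
  forall v, L v <-> exists k : int, L0 (v - g *~ k).

(* The quotient group L / L0 is generated by the class of some g, and this
   class has order exactly d. *)
Definition cyclic_quotient (L L0 : E -> Prop) (d : nat) : Prop :=
  exists2 g, gen_over L L0 g & forall k : int, L0 (g *~ k) <-> (d%:Z %| k)%Z.

Definition proj_fun (x v : E) : E := (dot v x / dot x x) *: x.

Fact proj_fun_is_linear x : linear (proj_fun x).
Proof.
move=> a u v; rewrite /proj_fun linearDl linearZl_LR /= mulrDl scalerDl.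
by rewrite scalerA mulrA.
Qed.

HB.instance Definition _ x :=
  GRing.isLinear.Build R E E *:%R (proj_fun x) (proj_fun_is_linear x).

Definition proj (x : E) : 'End(E) := linfun (proj_fun x).

Lemma proj_line x v : proj x v \in <[x]>%VS.
Proof. by rewrite lfunE; apply/memvZ/memv_line. Qed.

Lemma proj_ortho x v : x != 0 -> dot (v - proj x v) x = 0.
Proof.
move=> x0; rewrite lfunE /= /proj_fun linearBl linearZl_LR /= divfK ?subrr //.
by rewrite gt_eqF // neq0_dnorm_gt0.
Qed.

(* The last clause says that the terms on the two sides are pairwise distinct:
   a projection occurring on both sides could be cancelled. *)
Definition perfection_relation n (e e' : n.-tuple E) (lam lam' : 'I_n -> R) :
    Prop :=
  [/\ forall i, 0 < lam i, forall j, 0 < lam' j,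
      \sum_i lam i *: proj (tnth e i) = \sum_j lam' j *: proj (tnth e' j)
    & forall i j, proj (tnth e i) != proj (tnth e' j)].

End Lattices.

(* In what follows the families x, y : nat -> E and mu, mu' : nat -> R are
   indexed from 1 to n; other values are irrelevant. *)
Section Relations.
Variables (R : realType) (E : vectType R).

(* Up to a positive factor c, the relation
     \sum_i lam i *: proj e_i = \sum_j lam' j *: proj e'_j
   is term by term the relation
     \sum_i mu i *: proj x_i = \sum_j mu' j *: proj y_j,
   with signs allowed as proj z = proj (- z). *)
Definition same_relation n (e e' : n.-tuple E) (lam lam' : 'I_n -> R)
    (x y : nat -> E) (mu mu' : nat -> R) : Prop :=
  exists (s t : 'S_n) (c : R),
  [/\ 0 < c,
      forall i : 'I_n, (x i.+1 = tnth e (s i) \/ x i.+1 = - tnth e (s i)) /\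
                       lam (s i) = c * mu i.+1
    & forall j : 'I_n, (y j.+1 = tnth e' (t j) \/ y j.+1 = - tnth e' (t j)) /\
                       lam' (t j) = c * mu' j.+1].

(* (x_1 + ... + x_m1 + 2 (x_(m1+1) + ... + x_n)) / 4 *)
Definition quarter_vec (m1 n : nat) (x : nat -> E) : E :=
  4^-1 *: (\sum_(1 <= i < m1.+1) x i + 2 *: \sum_(m1.+1 <= i < n.+1) x i).

Definition vectors_a (x : nat -> E) (j : nat) : E :=
  let g := quarter_vec 4 7 x in
  let f := 2^-1 *: (x 1%N + x 2%N + x 3%N + x 4%N) in
  match j with
  | 1 => g
  | 2 => g - x 6%N - x 7%N
  | 3 => g - x 5%N - x 7%N
  | 4 => g - x 5%N - x 6%N
  | 5 => f - x 3%N - x 4%N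
  | 6 => f - x 2%N - x 4%N
  | 7 => f - x 2%N - x 3%N
  | _ => 0
  end.

Definition vectors_bc (m1 n : nat) (x : nat -> E) (j : nat) : E :=
  quarter_vec m1 n x - x j.

Definition coef_one (i : nat) : R := 1.

Definition coef_b (i : nat) : R := if (i <= 6)%N then 1 else 2.

End Relations.

(* Main.v *)
(* Change signs so that the generator of Lambda over Lambda_0 is a sum of
   c_i / 4 times e_i with c_i in {0, 1, 2}; let m1 and m2 be the numbers of ones
   and twos.  Watson's identity bounds m1 and m1 + 2 m2 from below and excludes
   (m1, m2) = (4, 2).  In the basis e_i, the relation says that
   sum_j lam'_j y_j y_j^T is diagonal with entries lam_i, where y_j is the
   coordinate vector of e'_j, and sum lam = sum lam'.  Hence any quadratic form
   taking the same value C at all e_i has lam'-average C over the e'_j; if it is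
   at least C on the nonzero vectors of Lambda, it equals C at each e'_j.  Two
   well-chosen forms leave (m1, m2) = (4, 3), (6, 1) or (8, 0), n = m1 + m2, and
   finitely many candidates for the e'_j.  The off-diagonal equations are then a
   linear system for the total weight carried by each candidate; as only n
   candidates have positive weight, it has the solutions of the theorem. *)
Require Import Defs.
From mathcomp Require Import all_boot all_order all_fingroup all_algebra.
From mathcomp Require Import sesquilinear reals.
From mathcomp Require Import zify ring lra.
Import Order.TTheory GRing.Theory Num.Theory.
Local Open Scope ring_scope.

Set Implicit Arguments.
Unset Strict Implicit.
Unset Printing Implicit Defensive.

(** * Minima of two quadratic forms on integer coordinate vectors *)

Lemma sqr_cases (a y : int) : y ^+ 2 = a ^+ 2 -> y = a \/ y = - a.
Proof. by move=> /eqP; rewrite eqf_sqr => /orP[]/eqP ->; [left | right]. Qed.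

Section IntegerColumns.
Variables (n : nat) (c : 'I_n -> nat).
Hypothesis c_le2 : forall i, (c i <= 2)%N.
Implicit Types (y w : 'I_n -> int) (k eps : int).

(** [ones] and [twos] are the numbers written m1 and m2 in the overview. *)
Definition ones : nat := \sum_i (c i == 1%N).
Definition twos : nat := \sum_i (c i == 2%N).

Definition sum_ones y : int := \sum_i (c i == 1%N)%:Z * y i.

(* [form5] is 80 at four times each coordinate vector; the cross terms of
   [sum_ones] raise its values on the coset of the generator to at least 80. *)
Definition form5 y : int :=
  \sum_i (5 - (c i == 1%N)%:Z) * y i ^+ 2 + sum_ones y ^+ 2.

(* Nonnegative on the coset of the generator, as (t - 1)(t + 3) >= 0 for every
   integer t = 1 mod 4. *)
Definition defect5 (a : nat) (t : int) : int :=
  (5 - (a == 1%N)%:Z) * t ^+ 2 + 8 * ((a == 1%N)%:Z * t)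
  - 12 * (a == 1%N)%:Z - 20 * (a == 2%N)%:Z.

Lemma PoszS (f : 'I_n -> nat) : (\sum_i f i)%N%:Z = \sum_i (f i)%:Z.
Proof. exact: (big_morph Posz PoszD erefl). Qed.

(** Completes the square in [sum_ones y]; the linear term [8 * sum_ones y] so produced is spread
    over the defects. *)
Lemma form5E y :
  form5 y = (12 * ones%:Z + 20 * twos%:Z - 16)
            + \sum_i defect5 (c i) (y i) + (sum_ones y - 4) ^+ 2.
Proof.
rewrite /form5 /defect5 !big_split /= !sumrN -!mulr_sumr.
rewrite -/(sum_ones y) /ones /twos !PoszS.
ring.
Qed.

Lemma defect5_ge0 (a : nat) (t w : int) :
  (a <= 2)%N -> t = a%:Z + 4 * w -> 0 <= defect5 a t.
Proof.
by rewrite /defect5 => a2 ->; case: a a2 => [|[|[|]]] //= _; nia.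
Qed.

Lemma sum_ones_mod4 y w k : (forall i, y i = k * (c i)%:Z + 4 * w i) ->
  sum_ones y = k * ones%:Z + 4 * sum_ones w.
Proof.
move=> yE; rewrite /sum_ones /ones PoszS !mulr_sumr -big_split /=.
apply: eq_bigr => i _; rewrite yE; by case: eqP => [->|_] /=; rewrite ?mul0r ?mul1r ?mulr0 ?mulr1.
Qed.

(** The residue of [k] modulo 4 decides, and the residue 3 becomes 1 under the sign [eps = -1]. The
    cases are the classes of 0, of the generator up to sign, and of twice the generator. *)
Lemma mod4_cases (y w : 'I_n -> int) k :
  (forall i, y i = k * (c i)%:Z + 4 * w i) ->
  [\/ exists v, forall i, y i = 4 * v i,
      exists eps v, (eps = 1 \/ eps = -1) /\
        forall i, eps * y i = (c i)%:Z + 4 * v i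
    | exists v, forall i, y i = 2 * (c i)%:Z + 4 * v i].
Proof.
move=> yE.
have [q [kE|[kE|[kE|kE]]]] : exists q, k = 4 * q \/ k = 4 * q + 1 \/
    k = 4 * q + 2 \/ k = 4 * q + 3.
  by exists (k %/ 4)%Z; lia.
- by constructor 1; exists (fun i => q * (c i)%:Z + w i) => i; rewrite yE kE; ring.
- constructor 2; exists 1, (fun i => q * (c i)%:Z + w i); split; first by left.
  by move=> i; rewrite yE kE; ring.
- by constructor 3; exists (fun i => q * (c i)%:Z + w i) => i; rewrite yE kE; ring.
- constructor 2; exists (-1), (fun i => - ((q + 1) * (c i)%:Z + w i)).
  split; first by right.
  by move=> i; rewrite yE kE; ring.
Qed.

(* [y] is neither zero nor four times a signed coordinate vector. *)
Definition nonunit y := forall w, (forall i, y i = 4 * w i) -> 2 <= \sum_i w i ^+ 2.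

(** Each class is bounded separately. The classes of 0 and of twice the generator stay above 80; on
    the odd classes the defects in [form5E] are nonnegative. The number 96 is 80 plus the 16
    subtracted in [form5E]. *)
Lemma form5_column y k w : (5 <= ones)%N -> (8 <= ones + twos.*2)%N ->
    nonunit y -> (forall i, y i = k * (c i)%:Z + 4 * w i) ->
  80 <= form5 y /\
  (form5 y = 80 -> exists eps v,
    [/\ eps = 1 \/ eps = -1, forall i, eps * y i = (c i)%:Z + 4 * v i,
        forall i, defect5 (c i) (eps * y i) = 0 &
        12 * ones%:Z + 20 * twos%:Z + (eps * sum_ones y - 4) ^+ 2 = 96]).
Proof.
move=> m5 m8 nu yE.
case: (mod4_cases yE) => [[v vE]|[eps [v [epsE vE]]]|[v vE]].
- have v2 := nu v vE.
  suff: 64 * \sum_i v i ^+ 2 <= form5 y by lia.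
  rewrite /form5 mulr_sumr -[leLHS]addr0 lerD ?sqr_ge0 //.
  by apply: ler_sum => i _; rewrite vE; case: (_ == _); nia.
- set z := fun i => eps * y i.
  have sz : sum_ones z = eps * sum_ones y.
    by rewrite /sum_ones mulr_sumr; apply: eq_bigr => i _; rewrite mulrCA.
  have qz : form5 z = form5 y.
    rewrite /form5 sz /z; congr (_ + _); last by case: epsE => ->; ring.
    by apply: eq_bigr => i _; case: epsE => ->; ring.
  have sm := @sum_ones_mod4 z v 1 (fun i => etrans (vE i) (congr1 (+%R^~ _) (esym (mul1r _)))).
  have def_ge0 i : true -> 0 <= defect5 (c i) (z i) by move=> _; exact: defect5_ge0 (vE i).
  have defs_ge0 : 0 <= \sum_i defect5 (c i) (z i) by apply: sumr_ge0.
  (* Five ones force two twos, seven ones force one, and both overshoot. Six ones and one two give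
     92, and the square adds at least 4, as [sum_ones z] is 2 modulo 4. Eight ones give exactly
     96. *)
  have key : 96 <= 12 * ones%:Z + 20 * twos%:Z + (sum_ones z - 4) ^+ 2.
    have sq0 := sqr_ge0 (sum_ones z - 4).
    have sq6 : ones = 6%N -> 4 <= (sum_ones z - 4) ^+ 2 by move=> m6; nia.
    lia.
  rewrite -qz form5E; split; first by lia.
  move=> q80; exists eps, v; split=> //.
    have def0 : \sum_i defect5 (c i) (z i) = 0 by lia.
    by move=> i; exact: (psumr_eq0P def_ge0 def0).
  by rewrite -sz; lia.
(* Here the entries at the ones are 2 modulo 4, and each contributes at least 16. Five ones give
   only 80, but then [sum_ones y] is 2 modulo 4 and its square adds at least 4. *)
- have sm := sum_ones_mod4 vE.
  have: 16 * ones%:Z <= \sum_i (5 - (c i == 1%N)%:Z) * y i ^+ 2.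
    rewrite /ones PoszS mulr_sumr; apply: ler_sum => i _; rewrite vE.
    by case: eqP => [->|_] /=; nia.
  rewrite /form5; nia.
Qed.

(** With four ones [form5] falls short: at entries 2, 2, -2, -2 on the ones and 0 elsewhere it is
    64. The sum of squares replaces it. It is at least 32 on the class of 0, at least
    [ones + 4 * twos] on the odd classes, and at least [4 * ones] on the class of twice the
    generator. *)
Lemma form1_column y k w : ones = 4%N -> (3 <= twos)%N ->
    nonunit y -> (forall i, y i = k * (c i)%:Z + 4 * w i) ->
  16 <= \sum_i y i ^+ 2 /\
  (\sum_i y i ^+ 2 = 16 ->
    (twos = 3%N /\ exists eps, (eps = 1 \/ eps = -1) /\
       forall i, (c i = 0%N -> y i = 0) /\ (c i = 1%N -> eps * y i = 1) /\
                 (c i = 2%N -> y i = 2 \/ y i = - 2)) \/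
    (forall i, (c i = 1%N -> y i = 2 \/ y i = - 2) /\ (c i <> 1%N -> y i = 0)) /\
    exists v, forall i, y i = 2 * v i).
Proof.
move=> m4 m3 nu yE.
case: (mod4_cases yE) => [[v vE]|[eps [v [epsE vE]]]|[v vE]].
- have v2 := nu v vE.
  suff: 16 * \sum_i v i ^+ 2 = \sum_i y i ^+ 2 by lia.
  by rewrite mulr_sumr; apply: eq_bigr => i _; rewrite vE; ring.
- pose D i := y i ^+ 2 - (c i == 1%N)%:Z - 4 * (c i == 2%N)%:Z.
  have D0 i : true -> 0 <= D i.
    move=> _; rewrite /D; have -> : y i ^+ 2 = (eps * y i) ^+ 2 by case: epsE => ->; ring.
    by rewrite vE; case: (c i) (c_le2 i) => [|[|[|]]] //= _; nia.
  have Dge0 : 0 <= \sum_i D i by apply: sumr_ge0.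
  have -> : \sum_i y i ^+ 2 = ones%:Z + 4 * twos%:Z + \sum_i D i.
    by rewrite /D !big_split /= !sumrN -mulr_sumr /ones /twos !PoszS; ring.
  split; first by lia.
  move=> q16; left; split; first by lia.
  exists eps; split=> // i.
  have D00 : \sum_i D i = 0 by lia.
  have Di : D i = 0 by exact: (psumr_eq0P D0 D00).
  move: Di (vE i); rewrite /D; case: (c i) (c_le2 i) => [|[|[|]]] //= _ Di vi.
  + by split=> // _; nia.
  + have [] : y i = 1 \/ y i = -1 by apply: sqr_cases; lia.
      by split=> //; split=> // _; case: epsE vi => -> vi; lia.
    by split=> //; split=> // _; case: epsE vi => -> vi; lia.
  + by split=> //; split=> // _; apply: sqr_cases; lia.
- pose D i := y i ^+ 2 - 4 * (c i == 1%N)%:Z.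
  have D0 i : true -> 0 <= D i.
    by move=> _; rewrite /D vE; case: (c i) (c_le2 i) => [|[|[|]]] //= _; nia.
  have Dge0 : 0 <= \sum_i D i by apply: sumr_ge0.
  have -> : \sum_i y i ^+ 2 = 4 * ones%:Z + \sum_i D i.
    by rewrite /D !big_split /= !sumrN -mulr_sumr /ones !PoszS; ring.
  split; first by lia.
  move=> q16; right; split=> [i|]; last first.
    by exists (fun i => (c i)%:Z + 2 * v i) => i; rewrite vE; ring.
  have D00 : \sum_i D i = 0 by lia.
  have Di : D i = 0 by exact: (psumr_eq0P D0 D00).
  move: Di (vE i); rewrite /D; case: (c i) (c_le2 i) => [|[|[|]]] //= _ Di vi.
  + by split=> // _; nia.
  + by split=> // _; apply: sqr_cases; lia.
  + by split=> // _; nia.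
Qed.

End IntegerColumns.

(** * Weighted averages of quadratic forms over the columns *)

Section Averaging.
Variables (R : realFieldType) (n : nat) (lam lam' : 'I_n -> R).
Variable y : 'I_n -> 'I_n -> int.
Hypothesis lam'_gt0 : forall j, 0 < lam' j.
Hypothesis gram : forall i k,
  \sum_j lam' j * (y j i * y j k)%:~R = 16 * lam i * (i == k)%:R.
Hypothesis mass_eq : \sum_i lam i = \sum_j lam' j.

(** The excesses [q j - C] are nonnegative, and by [mass_eq] their sum with the positive weights
    [lam'] is zero. *)
Lemma average_eq (q : 'I_n -> int) (C : int) : (forall j, C <= q j) ->
  \sum_j lam' j * (q j)%:~R = C%:~R * \sum_i lam i -> forall j, q j = C.
Proof.
move=> qC avg j; have D0 k : true -> 0 <= lam' k * (q k - C)%:~R.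
  by move=> _; rewrite mulr_ge0 ?(ltW (lam'_gt0 k)) // ler0z subr_ge0.
have D00 : \sum_k lam' k * (q k - C)%:~R = 0.
  under eq_bigr do rewrite rmorphB /= mulrBr.
  by rewrite sumrB avg -mulr_suml mass_eq mulrC subrr.
have /eqP := @psumr_eq0P _ _ _ _ D0 D00 j isT.
by rewrite mulf_eq0 gt_eqF //= intr_eq0 subr_eq0 => /eqP.
Qed.

Lemma average_form1 :
  \sum_j lam' j * (\sum_i y j i ^+ 2)%:~R = 16%:~R * \sum_i lam i.
Proof.
under eq_bigr do rewrite rmorph_sum mulr_sumr /=.
rewrite exchange_big mulr_sumr /=; apply: eq_bigr => i _.
by under eq_bigr do rewrite expr2; rewrite gram eqxx mulr1.
Qed.

(** The Gram equations annihilate the cross terms of [sum_ones]. Its diagonal terms restore each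
    coefficient to 5, and 80 is 5 times 16. *)
Lemma average_form5 (c : 'I_n -> nat) :
  \sum_j lam' j * (form5 c (y j))%:~R = 80%:~R * \sum_i lam i.
Proof.
have sq j : sum_ones c (y j) ^+ 2 =
    \sum_i \sum_k (c i == 1%N)%:Z * (c k == 1%N)%:Z * (y j i * y j k).
  rewrite expr2 {1}/sum_ones mulr_suml; apply: eq_bigr => i _.
  by rewrite /sum_ones mulr_sumr; apply: eq_bigr => k _; ring.
under eq_bigr do rewrite /form5 rmorphD /= sq mulrDr !rmorph_sum !mulr_sumr /=.
rewrite big_split /= exchange_big [X in _ + X]exchange_big -big_split mulr_sumr /=.
apply: eq_bigr => i _.
under [X in _ + X]eq_bigr do rewrite rmorph_sum mulr_sumr /=.
rewrite exchange_big /= [X in _ + X](bigD1 i) //= [X in _ + (_ + X)]big1 => [|k ki].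
  have -> : \sum_j lam' j * ((c i == 1%N)%:Z * (c i == 1%N)%:Z * (y j i * y j i))%:~R
    = (c i == 1%N)%:R * \sum_j lam' j * (y j i * y j i)%:~R.
    rewrite mulr_sumr; apply: eq_bigr => j _; case: (_ == _) => /=.
      by rewrite !mul1r.
    by rewrite !mul0r mulr0.
  have -> : \sum_j lam' j * ((5 - (c i == 1%N)%:Z) * y j i ^+ 2)%:~R
    = (5 - (c i == 1%N)%:R) * \sum_j lam' j * (y j i * y j i)%:~R.
    rewrite mulr_sumr; apply: eq_bigr => j _; rewrite expr2 rmorphM /= mulrCA.
    by congr (_ * _); rewrite rmorphB /=; case: (_ == _).
  by rewrite gram eqxx; case: (c i == 1%N) => /=; ring.
have -> : \sum_j lam' j * ((c i == 1%N)%:Z * (c k == 1%N)%:Z * (y j i * y j k))%:~R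
    = ((c i == 1%N)%:Z * (c k == 1%N)%:Z)%:~R * \sum_j lam' j * (y j i * y j k)%:~R.
  by rewrite mulr_sumr; apply: eq_bigr => j _; rewrite [X in _ * X]rmorphM /= mulrCA.
by rewrite gram [i == k]eq_sym (negPf ki) !mulr0.
Qed.

End Averaging.

(** * Equality cases and the three possible pairs of numbers of ones and twos *)

Lemma sum_eq_gt0 n (c : 'I_n -> nat) (a : nat) :
  (0 < \sum_i (c i == a))%N -> exists i, c i = a.
Proof.
move=> s0; case: (pickP (fun i => c i == a)) => [i /eqP|no]; first by exists i.
by move: s0; rewrite big1 // => i _; rewrite no.
Qed.

(** For [a] equal to 0, 1, 2 the defect is 5 t^2, 4 (t - 1)(t + 3) and 5 (t^2 - 4). *)
Lemma defect5_eq0 (a : nat) (t : int) : (a <= 2)%N -> defect5 a t = 0 ->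
  [/\ a = 0%N -> t = 0, a = 1%N -> t = 1 \/ t = -3 & a = 2%N -> t = 2 \/ t = -2].
Proof.
rewrite /defect5; case: a => [|[|[|]]] //= _ D; split=> // _.
- by nia.
- have [] : t + 1 = 2 \/ t + 1 = - 2 by apply: sqr_cases; lia.
    by left; lia.
  by right; lia.
- by apply: sqr_cases; lia.
Qed.

(** The first alternative covers the odd classes, the second the class of twice the generator. *)
Definition column_a n (c : 'I_n -> nat) (y : 'I_n -> int) : Prop :=
  (exists2 eps : int, eps = 1 \/ eps = -1 &
     forall i, (c i = 1%N -> eps * y i = 1) /\ (c i = 2%N -> y i = 2 \/ y i = -2))
  \/ (forall i, (c i = 1%N -> y i = 2 \/ y i = -2) /\ (c i = 2%N -> y i = 0)).

(** [S] lists the sums allowed by the square term of [form5E]: 4 plus or minus 2 for six ones and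
    one two, and 4 for eight ones. *)
Definition column_bc n (c : 'I_n -> nat) (S : seq int) (y : 'I_n -> int) : Prop :=
  exists eps : int, [/\ eps = 1 \/ eps = -1, eps * sum_ones c y \in S &
    forall i, (c i = 1%N -> eps * y i = 1 \/ eps * y i = -3) /\
              (c i = 2%N -> eps * y i = 2 \/ eps * y i = -2)].

Section ColumnTypes.
Variables (R : realFieldType) (n : nat) (lam lam' : 'I_n -> R).
Variables (c : 'I_n -> nat) (y : 'I_n -> 'I_n -> int).
Hypothesis lam_gt0 : forall i, 0 < lam i.
Hypothesis lam'_gt0 : forall j, 0 < lam' j.
Hypothesis gram : forall i k,
  \sum_j lam' j * (y j i * y j k)%:~R = 16 * lam i * (i == k)%:R.
Hypothesis mass_eq : \sum_i lam i = \sum_j lam' j.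
Hypothesis c_le2 : forall i, (c i <= 2)%N.
Hypothesis yE : forall j, exists k w, forall i, y j i = k * (c i)%:Z + 4 * w i.
Hypothesis nonunit_y : forall j, nonunit (y j).
Hypothesis ones_ge4 : (4 <= ones c)%N.
Hypothesis ones_twos_ge8 : (8 <= ones c + (twos c).*2)%N.
Hypothesis not_42 : ones c = 4%N -> twos c <> 2%N.

(** The diagonal Gram entry is positive. This rules out [c i = 0], since equality would make that
    coordinate vanish in every column. *)
Lemma row_neq0 i : exists j, y j i != 0.
Proof.
apply/existsP; rewrite -negb_forall; apply/negP => /forallP y0.
have := gram i i; rewrite eqxx mulr1 big1 => [/eqP|j _].
  by rewrite eq_sym mulf_eq0 pnatr_eq0 /= gt_eqF.
by rewrite (eqP (y0 j)) mul0r mulr0.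
Qed.

(** By [average_eq] every column is an equality case, of [form1_column] when there are four ones and
    of [form5_column] when there are more. *)
Lemma column_types :
  [\/ [/\ ones c = 4%N, twos c = 3%N, forall i, c i <> 0%N
        & forall j, column_a c (y j)],
      [/\ ones c = 6%N, twos c = 1%N, forall i, c i <> 0%N
        & forall j, column_bc c [:: 2; 6] (y j)]
    | [/\ ones c = 8%N, twos c = 0%N, forall i, c i <> 0%N
        & forall j, column_bc c [:: 4] (y j)]].
Proof.
case: (leqP 5 (ones c)) => m1; last first.
  have m4 : ones c = 4%N by lia.
  have m3 : (3 <= twos c)%N by move: (not_42 m4); lia.
  have type j : _ := let: ex_intro k (ex_intro w ykw) := yE j in
    form1_column c_le2 m4 m3 (@nonunit_y j) ykw.
  have {}type j := (type j).2 (average_eq lam'_gt0 mass_eq (fun j => (type j).1)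
                                (average_form1 gram) j).
  (* Some column is nonzero at a coordinate with [c i = 2]. It must lie in an odd class, where
     equality needs exactly three twos. *)
  have m3' : twos c = 3%N.
    have [i ci] : exists i, c i = 2%N.
      by apply: sum_eq_gt0; rewrite -/(twos c); lia.
    have [j /eqP yji] := row_neq0 i.
    by case: (type j) => [[]//|[/(_ i)[_ y0] _]]; case: yji; apply: y0; rewrite ci.
  constructor 1; split=> // [i ci|j].
    have [j /eqP yji] := row_neq0 i; case: yji.
    case: (type j) => [[_ [eps [_ /(_ i)[y0 _]]]]|[/(_ i)[_ y0] _]]; first exact: y0.
    by apply: y0; rewrite ci.
  case: (type j) => [[_ [eps [epsE te]]]|[te _]]; [left; exists eps|right] => // i.
    by case: (te i) => _.
  by case: (te i) => y1 y0; split=> // ci; apply: y0; rewrite ci.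
have type j : _ := let: ex_intro k (ex_intro w ykw) := yE j in
  form5_column c_le2 m1 ones_twos_ge8 (@nonunit_y j) ykw.
have {}type j := (type j).2 (average_eq lam'_gt0 mass_eq (fun j => (type j).1)
                              (average_form5 gram c) j).
have c0 i : c i <> 0%N.
  move=> ci; have [j /eqP yji] := row_neq0 i; case: yji.
  have [eps [v [epsE _ /(_ i)/(defect5_eq0 (c_le2 i))[/(_ ci) y0 _ _] _]]] := type j.
  by case: epsE y0 => ->; lia.
(* Columns and coordinates share the index type, so [i0] also names a column, and any one column
   will do. *)
have [i0 _] : exists i, c i = 1%N.
  by apply: sum_eq_gt0; rewrite -/(ones c); lia.
have col j (S : seq int) : (forall s : int, 12 * (ones c)%:Z + 20 * (twos c)%:Z
    + (s - 4) ^+ 2 = 96 -> s \in S) -> column_bc c S (y j).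
  move=> sS; have [eps [v [epsE _ def sum]]] := type j.
  exists eps; split=> [//||i]; first exact: sS.
  by have [_ ? ?] := defect5_eq0 (c_le2 i) (def i).
have [eps [v [_ vE _ sum]]] := type i0.
have smod : eps * sum_ones c (y i0) = (ones c)%:Z + 4 * sum_ones c v.
  rewrite -[X in X + _]mul1r -(@sum_ones_mod4 _ _ (fun i => eps * y i0 i)).
    by rewrite /sum_ones mulr_sumr; apply: eq_bigr => i _; rewrite mulrCA.
  by move=> i; rewrite vE mul1r.
have [[o t]|[o t]] : ones c = 6%N /\ twos c = 1%N \/ ones c = 8%N /\ twos c = 0%N.
  have sq0 := sqr_ge0 (eps * sum_ones c (y i0) - 4).
  have : ones c = 5%N -> (2 <= twos c)%N by lia.
  have : (12 * ones c + 20 * twos c <= 96)%N by lia.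
  have : ones c = 7%N -> twos c <> 0%N by lia.
  lia.
- constructor 2; split=> // j; apply: col => s; rewrite o t !inE => s96.
  have [] : s - 4 = 2 \/ s - 4 = - 2 by apply: sqr_cases; lia.
    by lia.
  by lia.
- constructor 3; split=> // j; apply: col => s; rewrite o t !inE => s96.
  have [] : s - 4 = 0 \/ s - 4 = - 0 by apply: sqr_cases; lia.
    by lia.
  by lia.
Qed.

End ColumnTypes.

(** * Total weights of classes of columns *)

Section Classes.
Variables (R : realFieldType) (n : nat) (lam' : 'I_n -> R) (cls : 'I_n -> nat).

Definition mass (q : nat) : R := \sum_(j | cls j == q) lam' j.

Lemma mass_neq0 q : mass q != 0 -> q \in codom cls.
Proof.
apply: contraNT => qP; rewrite /mass big1 // => j /eqP qj.
by rewrite -qj codom_f in qP.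
Qed.

(** A class of nonzero mass contains a column, and there are only [n] columns. *)
Lemma size_mass_neq0 (S : seq nat) :
  uniq S -> (forall q, q \in S -> mass q != 0) -> (size S <= n)%N.
Proof.
move=> uS S0; rewrite -[n in (_ <= n)%N]card_ord -(size_codom cls).
by apply: uniq_leq_size => // q /S0/mass_neq0.
Qed.

(** When [n] classes have nonzero mass they exhaust the [n] columns. Hence [cls] is injective, and
    each of these masses is a single coefficient. *)
Lemma perm_of_masses (S : seq nat) : uniq S -> size S = n ->
    (forall q, q \in S -> mass q != 0) ->
  (forall q, q \notin S -> mass q = 0) /\
  exists t : 'S_n, forall j, cls (t j) = nth 0%N S j /\ lam' (t j) = mass (nth 0%N S j).
Proof.
move=> uS sS S0.
have sub : {subset S <= codom cls} by move=> q /S0/mass_neq0.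
have sz : (size (codom cls) <= size S)%N by rewrite size_codom card_ord sS.
have [_ S_codom] := uniq_min_size uS sub sz.
have cls_inj : injective cls by apply/injectiveP; exact: leq_size_uniq sub sz.
split=> [q|].
  by rewrite S_codom => qP; apply/eqP; apply: contraNT qP => /mass_neq0.
have /fin_all_exists[t0 t0E] : forall j : 'I_n, exists i, cls i = nth 0%N S j.
  move=> j; have /codomP[i ->] : nth 0%N S j \in codom cls by rewrite sub ?mem_nth ?sS.
  by exists i.
have t0_inj : injective t0.
  move=> i j /(congr1 cls); rewrite !t0E => /eqP.
  by rewrite nth_uniq ?sS // => /eqP/val_inj.
exists (perm t0_inj) => j; rewrite permE t0E; split=> //.
rewrite /mass (eq_bigl (pred1 (t0 j))) ?big_pred1_eq // => i /=.
by rewrite -t0E (inj_eq cls_inj).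
Qed.

(** Columns of one class agree up to a sign, which cancels in the product of two entries. *)
Lemma gram_mass (C : seq (seq int)) (y : 'I_n -> nat -> int) (i k : nat) :
    (forall j, exists2 eps : int, eps = 1 \/ eps = -1 &
       y j i = eps * (nth [::] C (cls j))`_i /\ y j k = eps * (nth [::] C (cls j))`_k) ->
    (forall j, (cls j < size C)%N) ->
  \sum_j lam' j * (y j i * y j k)%:~R =
  \sum_(0 <= q < size C) mass q * ((nth [::] C q)`_i * (nth [::] C q)`_k)%:~R.
Proof.
move=> yE clsC; pose p j := Ordinal (clsC j).
rewrite (partition_big p xpredT) //= big_mkord; apply: eq_bigr => q _.
rewrite /mass mulr_suml; apply: eq_big => [j|j /eqP <-]; first by rewrite -val_eqE.
have [eps epsE [-> ->]] := yE j; congr (_ * _%:~R).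
by rewrite mulrACA; case: epsE => -> /=; rewrite ?mulrNN !mul1r.
Qed.

End Classes.

(** * Lists of the candidate columns *)

Lemma class_of_columns n (C : seq (seq int)) (y : 'I_n -> nat -> int) :
    (forall j, exists2 eps : int, eps = 1 \/ eps = -1 &
       [seq eps * y j i | i <- iota 0 n] \in C) ->
  exists cls : 'I_n -> nat, forall j, (cls j < size C)%N /\
    exists2 eps : int, eps = 1 \/ eps = -1 &
      forall i, (i < n)%N -> y j i = eps * (nth [::] C (cls j))`_i.
Proof.
move=> yC.
have /fin_all_exists[cls clsP] : forall j : 'I_n, exists q, (q < size C)%N /\
    exists2 eps : int, eps = 1 \/ eps = -1 &
      forall i, (i < n)%N -> y j i = eps * (nth [::] C q)`_i; last by exists cls.
move=> j; have [eps epsE yj] := yC j.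
exists (index [seq eps * y j i | i <- iota 0 n] C); rewrite index_mem; split=> //.
exists eps => // i lt_in.
rewrite nth_index // (nth_map 0%N) ?size_iota // nth_iota // add0n.
by case: epsE => -> /=; rewrite ?mulNr ?mulrN ?opprK !mul1r.
Qed.

(* Entries are multiplied by 4.  The columns 0 to 6 of [cols_a] and [cols_b] and
   all those of [cols_c] are the vectors e'_j of the three relations, in order. *)
Definition cols_a : seq (seq int) :=
  [:: [:: 1; 1; 1; 1; 2; 2; 2];    [:: 1; 1; 1; 1; 2; -2; -2];
      [:: 1; 1; 1; 1; -2; 2; -2];  [:: 1; 1; 1; 1; -2; -2; 2];
      [:: 2; 2; -2; -2; 0; 0; 0];  [:: 2; -2; 2; -2; 0; 0; 0];
      [:: 2; -2; -2; 2; 0; 0; 0];  [:: 2; 2; 2; 2; 0; 0; 0];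
      [:: 1; 1; 1; 1; 2; 2; -2];   [:: 1; 1; 1; 1; 2; -2; 2];
      [:: 1; 1; 1; 1; -2; 2; 2];   [:: 1; 1; 1; 1; -2; -2; -2];
      [:: 2; 2; 2; -2; 0; 0; 0];   [:: 2; 2; -2; 2; 0; 0; 0];
      [:: 2; -2; 2; 2; 0; 0; 0];   [:: 2; -2; -2; -2; 0; 0; 0]].

Definition cols_b : seq (seq int) :=
  [:: [:: -3; 1; 1; 1; 1; 1; 2];   [:: 1; -3; 1; 1; 1; 1; 2];
      [:: 1; 1; -3; 1; 1; 1; 2];   [:: 1; 1; 1; -3; 1; 1; 2];
      [:: 1; 1; 1; 1; -3; 1; 2];   [:: 1; 1; 1; 1; 1; -3; 2];
      [:: 1; 1; 1; 1; 1; 1; -2];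
      [:: -3; 1; 1; 1; 1; 1; -2];  [:: 1; -3; 1; 1; 1; 1; -2];
      [:: 1; 1; -3; 1; 1; 1; -2];  [:: 1; 1; 1; -3; 1; 1; -2];
      [:: 1; 1; 1; 1; -3; 1; -2];  [:: 1; 1; 1; 1; 1; -3; -2];
      [:: 1; 1; 1; 1; 1; 1; 2]].

Definition cols_c : seq (seq int) :=
  [:: [:: -3; 1; 1; 1; 1; 1; 1; 1]; [:: 1; -3; 1; 1; 1; 1; 1; 1];
      [:: 1; 1; -3; 1; 1; 1; 1; 1]; [:: 1; 1; 1; -3; 1; 1; 1; 1];
      [:: 1; 1; 1; 1; -3; 1; 1; 1]; [:: 1; 1; 1; 1; 1; -3; 1; 1];
      [:: 1; 1; 1; 1; 1; 1; -3; 1]; [:: 1; 1; 1; 1; 1; 1; 1; -3]].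

(** Each alternative leaves eight sign patterns: those of the last three entries when the first four
    are made 1, and those of the second to fourth entries when the first is made 2. *)
Lemma cols_aP (f : nat -> int) :
    (exists2 eps : int, eps = 1 \/ eps = -1 & forall i, (i < 7)%N ->
       ((i < 4)%N -> eps * f i = 1) /\ ((4 <= i)%N -> f i = 2 \/ f i = -2))
    \/ (forall i, (i < 7)%N ->
       ((i < 4)%N -> f i = 2 \/ f i = -2) /\ ((4 <= i)%N -> f i = 0)) ->
  exists2 eps : int, eps = 1 \/ eps = -1 & [seq eps * f i | i <- iota 0 7] \in cols_a.
Proof.
case=> [[eps epsE fE]|fE].
- exists eps => //=.
  rewrite (fE 0%N isT).1 // (fE 1%N isT).1 // (fE 2%N isT).1 // (fE 3%N isT).1 //.
  by case: epsE => ->; case: ((fE 4%N isT).2 isT) => ->;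
    case: ((fE 5%N isT).2 isT) => ->; case: ((fE 6%N isT).2 isT) => ->.
- have [eps epsE f0] : exists2 eps : int, eps = 1 \/ eps = -1 & eps * f 0%N = 2.
    by case: ((fE 0%N isT).1 isT) => ->; [exists 1|exists (-1)]; auto.
  exists eps => //=; rewrite f0.
  rewrite (fE 4%N isT).2 // (fE 5%N isT).2 // (fE 6%N isT).2 // mulr0.
  by case: epsE => ->; case: ((fE 1%N isT).1 isT) => ->;
    case: ((fE 2%N isT).1 isT) => ->; case: ((fE 3%N isT).1 isT) => ->.
Qed.

(** The sum drops from 6 by 4 for each entry -3, so there is at most one such entry. *)
Lemma cols_bP (f : nat -> int) :
    (forall i, (i < 7)%N -> ((i < 6)%N -> f i = 1 \/ f i = -3) /\
                            ((6 <= i)%N -> f i = 2 \/ f i = -2)) ->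
    \sum_(0 <= i < 6) f i \in [:: 2; 6] ->
  [seq f i | i <- iota 0 7] \in cols_b.
Proof.
move=> fE; rewrite unlock /=.
by case: ((fE 0%N isT).1 isT) => ->; case: ((fE 1%N isT).1 isT) => ->;
  case: ((fE 2%N isT).1 isT) => ->; case: ((fE 3%N isT).1 isT) => ->;
  case: ((fE 4%N isT).1 isT) => ->; case: ((fE 5%N isT).1 isT) => ->;
  case: ((fE 6%N isT).2 isT) => ->.
Qed.

(** The sum drops from 8 by 4 for each entry -3, so there is exactly one such entry. *)
Lemma cols_cP (f : nat -> int) :
    (forall i, (i < 8)%N -> f i = 1 \/ f i = -3) -> \sum_(0 <= i < 8) f i = 4 ->
  [seq f i | i <- iota 0 8] \in cols_c.
Proof.
move=> fE; rewrite unlock /= => /eqP.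
by case: (fE 0%N isT) => ->; case: (fE 1%N isT) => ->;
  case: (fE 2%N isT) => ->; case: (fE 3%N isT) => ->;
  case: (fE 4%N isT) => ->; case: (fE 5%N isT) => ->;
  case: (fE 6%N isT) => ->; case: (fE 7%N isT) => ->.
Qed.

(** * The linear systems for the masses *)

Section Solve.
Variables (R : realFieldType) (M lam : nat -> R).

Definition gram_eq (n : nat) (C : seq (seq int)) : Prop :=
  forall i k, (i < n)%N -> (k < n)%N ->
  \sum_(0 <= q < size C) M q * ((nth [::] C q)`_i * (nth [::] C q)`_k)%:~R
    = 16 * lam i * (i == k)%:R.

(** The entries meeting the last three coordinates see only the columns 0 to 3 and 8 to 11. They say
    that the masses, as a function of three signs, are orthogonal to all products of one or two
    signs; so the masses depend only on the product of the three signs. The entries among the first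
    four coordinates then settle the other columns in the same way. *)
Lemma solve_a : gram_eq 7 cols_a ->
  [/\ [/\ M 1%N = M 0%N, M 2%N = M 0%N & M 3%N = M 0%N],
      [/\ M 9%N = M 8%N, M 10%N = M 8%N & M 11%N = M 8%N],
      [/\ M 13%N = M 12%N, M 14%N = M 12%N & M 15%N = M 12%N],
      [/\ M 4%N = M 7%N + (M 0%N + M 8%N), M 5%N = M 4%N & M 6%N = M 4%N]
    & forall i, (i < 7)%N ->
        4 * lam i = if (i < 4)%N then M 0%N + M 8%N + M 7%N + 3 * M 4%N + 4 * M 12%N
                    else 4 * (M 0%N + M 8%N)].
Proof.
move=> E.
have e i k lt_i7 lt_k7 := E i k lt_i7 lt_k7; rewrite unlock /= in e.
have e01 := e 0%N 1%N isT isT.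
have e02 := e 0%N 2%N isT isT.
have e03 := e 0%N 3%N isT isT.
have e12 := e 1%N 2%N isT isT.
have e13 := e 1%N 3%N isT isT.
have e23 := e 2%N 3%N isT isT.
have e04 := e 0%N 4%N isT isT.
have e05 := e 0%N 5%N isT isT.
have e06 := e 0%N 6%N isT isT.
have e45 := e 4%N 5%N isT isT.
have e46 := e 4%N 6%N isT isT.
have e56 := e 5%N 6%N isT isT.
rewrite /= in e01 e02 e03 e12 e13 e23 e04 e05 e06 e45 e46 e56.
have [M1 M2 M3] : [/\ M 1%N = M 0%N, M 2%N = M 0%N & M 3%N = M 0%N].
  by clear e01 e02 e03 e12 e13 e23; split; lra.
have [M9 M10 M11] : [/\ M 9%N = M 8%N, M 10%N = M 8%N & M 11%N = M 8%N].
  by clear e01 e02 e03 e12 e13 e23; split; lra.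
clear e04 e05 e06 e45 e46 e56.
rewrite M1 M2 M3 M9 M10 M11 in e01 e02 e03 e12 e13 e23.
have [M13 M14 M15] : [/\ M 13%N = M 12%N, M 14%N = M 12%N & M 15%N = M 12%N] by split; lra.
have [M4 M5 M6] : [/\ M 4%N = M 7%N + (M 0%N + M 8%N), M 5%N = M 4%N & M 6%N = M 4%N] by split; lra.
split=> // i lt_i7; have := e i i lt_i7 lt_i7.
rewrite eqxx M1 M2 M3 M9 M10 M11 M13 M14 M15 M5 M6 M4.
by case: i lt_i7 => [|[|[|[|[|[|[|]]]]]]] //= _ ?; lra.
Qed.

(** Entries with the last coordinate constrain the differences of the masses of columns that differ
    only in the last sign; the other entries constrain their sums. In both systems the first six
    unknowns are equal and the seventh is their double. *)
Lemma solve_b : gram_eq 7 cols_b ->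
  [/\ forall i, (i < 6)%N -> M i = M 0%N /\ M (7 + i)%N = M 7%N,
      M 6%N = 2 * M 0%N, M 13%N = 2 * M 7%N
    & forall i, (i < 7)%N ->
        lam i = if (i < 6)%N then M 0%N + M 7%N else 2 * (M 0%N + M 7%N)].
Proof.
move=> E.
have e i k lt_i7 lt_k7 := E i k lt_i7 lt_k7; rewrite unlock /= in e.
have e01 := e 0%N 1%N isT isT.
have e02 := e 0%N 2%N isT isT.
have e03 := e 0%N 3%N isT isT.
have e04 := e 0%N 4%N isT isT.
have e05 := e 0%N 5%N isT isT.
(* The entries [e01] to [e05] equate the sums for the indices 1 to 5; [e12] brings in the index
   0. *)
have e12 := e 1%N 2%N isT isT.
have e06 := e 0%N 6%N isT isT.
have e16 := e 1%N 6%N isT isT.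
have e26 := e 2%N 6%N isT isT.
have e36 := e 3%N 6%N isT isT.
have e46 := e 4%N 6%N isT isT.
have e56 := e 5%N 6%N isT isT.
rewrite /= in e01 e02 e03 e04 e05 e12 e06 e16 e26 e36 e46 e56.
have [M1 M2 M3 M4 M5] : [/\ M 1%N = M 0%N, M 2%N = M 0%N, M 3%N = M 0%N, M 4%N = M 0%N & M 5%N = M 0%N].
  by split; lra.
have [M8 M9 M10 M11 M12] :
  [/\ M 8%N = M 7%N, M 9%N = M 7%N, M 10%N = M 7%N, M 11%N = M 7%N & M 12%N = M 7%N] by split; lra.
have M6 : M 6%N = 2 * M 0%N by lra.
have M13 : M 13%N = 2 * M 7%N by lra.
split=> //; first by case=> [|[|[|[|[|[|]]]]]].
move=> i lt_i7; have := e i i lt_i7 lt_i7.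
rewrite eqxx M1 M2 M3 M4 M5 M6 M8 M9 M10 M11 M12 M13.
by case: i lt_i7 => [|[|[|[|[|[|[|]]]]]]] //= _ ?; lra.
Qed.

(** The off-diagonal entry at [i], [k] makes [4 * (M i + M k)] equal to the total mass, so all
    masses agree. *)
Lemma solve_c : gram_eq 8 cols_c ->
  forall i, (i < 8)%N -> M i = M 0%N /\ lam i = M 0%N.
Proof.
move=> E.
have e i k lt_i7 lt_k7 := E i k lt_i7 lt_k7; rewrite unlock /= in e.
have e01 := e 0%N 1%N isT isT.
have e02 := e 0%N 2%N isT isT.
have e03 := e 0%N 3%N isT isT.
have e04 := e 0%N 4%N isT isT.
have e05 := e 0%N 5%N isT isT.
have e06 := e 0%N 6%N isT isT.
have e07 := e 0%N 7%N isT isT.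
have e12 := e 1%N 2%N isT isT.
rewrite /= in e01 e02 e03 e04 e05 e06 e07 e12.
have [M1 M2 M3 M4 M5] : [/\ M 1%N = M 0%N, M 2%N = M 0%N, M 3%N = M 0%N, M 4%N = M 0%N & M 5%N = M 0%N].
  by split; lra.
have M6 : M 6%N = M 0%N by lra.
have M7 : M 7%N = M 0%N by lra.
move=> i lt_i8; split; first by case: i lt_i8 => [|[|[|[|[|[|[|[|]]]]]]]].
have := e i i lt_i8 lt_i8; rewrite eqxx M1 M2 M3 M4 M5 M6 M7.
by case: i lt_i8 => [|[|[|[|[|[|[|[|]]]]]]]] //= _ ?; lra.
Qed.

End Solve.

(** * Selecting the columns that carry weight *)

Section Classify.
Variables (R : realFieldType) (n : nat).
Local Notation N := n.+1.
Variables (lam lam' : 'I_N -> R) (y : 'I_N -> nat -> int).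
Hypothesis lam_gt0 : forall i, 0 < lam i.
Hypothesis lam'_gt0 : forall j, 0 < lam' j.
Hypothesis gram : forall i k : 'I_N,
  \sum_j lam' j * (y j i * y j k)%:~R = 16 * lam i * (i == k)%:R.

(* [flip] accounts for replacing the seventh basis vector by its opposite. *)
Definition matches (C : seq (seq int)) (coef : nat -> R) : Prop :=
  exists (flip : bool) (t : 'S_N) (p : R),
  [/\ (flip -> n = 6%N), 0 < p & forall j : 'I_N,
    [/\ lam j = p * coef j, lam' (t j) = p * coef j &
        exists2 eps : int, eps = 1 \/ eps = -1 & forall i : 'I_N,
          y (t j) i = eps * (if flip && (i == 6%N :> nat)
                             then - (nth [::] C j)`_i else (nth [::] C j)`_i)]].

Section Masses.
Variables (C : seq (seq int)) (cls : 'I_N -> nat).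
Hypothesis clsP : forall j, (cls j < size C)%N /\
  exists2 eps : int, eps = 1 \/ eps = -1 &
    forall i, (i < N)%N -> y j i = eps * (nth [::] C (cls j))`_i.

Lemma gram_eq_mass : gram_eq (mass lam' cls) (fun i => lam (inord i)) N C.
Proof.
move=> i k ltiN ltkN; rewrite -(@gram_mass _ _ lam' cls C y).
- have := gram (inord i) (inord k); rewrite !inordK // => ->.
  by rewrite -val_eqE /= !inordK.
- move=> j; have [_ [eps epsE yE]] := clsP j.
  by exists eps => //; rewrite !yE.
- by move=> j; have [] := clsP j.
Qed.

Lemma mass_ge0 q : 0 <= mass lam' cls q.
Proof. by apply: sumr_ge0 => j _; apply: ltW. Qed.

(** [S] names the classes that carry weight, in the order of the vectors e'_j; up to the flip they
    are the first columns of [C]. The vanishing of all other masses is made available for computing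
    [lam]. *)
Lemma matches_of_masses (coef : nat -> R) (flip : bool) (p : R) (S : seq nat) :
    (flip -> n = 6%N) -> uniq S -> size S = N -> 0 < p -> (forall j, (j < N)%N -> 0 < coef j) ->
    (forall j, (j < N)%N -> mass lam' cls (nth 0%N S j) = p * coef j) ->
    ((forall q, q \notin S -> mass lam' cls q = 0) ->
      forall j : 'I_N, lam j = p * coef j) ->
    (forall i j, (i < N)%N -> (j < N)%N -> (nth [::] C (nth 0%N S j))`_i =
       if flip && (i == 6%N) then - (nth [::] C j)`_i else (nth [::] C j)`_i) ->
  matches C coef.
Proof.
move=> flip7 uS sS p0 coef0 massE lamE flipE.
have S0 q : q \in S -> mass lam' cls q != 0.
  move=> qS; rewrite -(nth_index 0%N qS) massE -?sS ?index_mem //.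
  by rewrite mulf_neq0 ?gt_eqF ?coef0 // -sS index_mem.
have [out [t tE]] := perm_of_masses uS sS S0.
exists flip, t, p; split=> // j; have [clst ->] := tE j.
split; [exact: lamE | exact: massE |].
have [_ [eps epsE yE]] := clsP (t j); exists eps => // i.
by rewrite yE // clst flipE.
Qed.

End Masses.
End Classify.

Lemma size_mass_neq0_all (R : realFieldType) n (lam' : 'I_n -> R) cls (S : seq nat) :
  uniq S -> (n < size S)%N -> ~ all (fun q => mass lam' cls q != 0) S.
Proof. by move=> uS lt_nS /allP/(size_mass_neq0 uS); rewrite leqNgt lt_nS. Qed.

(** The masses agree within each of the blocks 0 to 3, 8 to 11 and 4 to 6, and the last block is
    positive. As at most seven classes carry weight, exactly one of the first two blocks survives,
    and class 7 has mass zero. *)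
Lemma classify_a (R : realFieldType) (lam lam' : 'I_7 -> R) (y : 'I_7 -> nat -> int) :
    (forall i, 0 < lam i) -> (forall j, 0 < lam' j) ->
    (forall i k : 'I_7,
      \sum_j lam' j * (y j i * y j k)%:~R = 16 * lam i * (i == k)%:R) ->
    (forall j, exists2 eps : int, eps = 1 \/ eps = -1 &
       [seq eps * y j i | i <- iota 0 7] \in cols_a) ->
  matches lam lam' y cols_a (fun=> 1).
Proof.
move=> lam_gt0 lam'_gt0 gram /class_of_columns[cls clsP].
have := mass_ge0 lam'_gt0 cls; have few := @size_mass_neq0_all _ _ lam' cls.
have := solve_a (gram_eq_mass gram clsP).
have build := @matches_of_masses _ _ lam lam' y _ _ clsP (fun=> 1).
move: (mass lam' cls) few build => M few build.
case=> [[M1 M2 M3] [M9 M10 M11] _ [M4 M5 M6] lam_eq] M0.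
have M08 : 0 < M 0%N + M 8%N.
  by have := lam_eq 4%N isT; have := lam_gt0 (inord 4); rewrite /=; lra.
have M4_neq0 : M 4%N != 0 by have := M0 7%N; lra.
have lamE (p : R) : M 0%N + M 8%N = p -> M 4%N = p -> M 7%N = 0 -> M 12%N = 0 ->
    forall j, lam j = p * 1.
  move=> M08p M4p M7 M12 j; rewrite mulr1 -[j]inord_val.
  by have := lam_eq j (ltn_ord j); case: ifP => _; rewrite ?M08p ?M4p ?M7 ?M12; lra.
have [M80|M80] := eqVneq (M 8%N) 0.
- have M0_neq0 : M 0%N != 0 by move: M08; rewrite M80 addr0 => /gt_eqF ->.
  have M7 : M 7%N = 0.
    apply/eqP/negPn/negP => M7; case: (few (iota 0 8)) => //=.
    by rewrite M1 M2 M3 M5 M6 M0_neq0 M4_neq0 M7.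
  apply: (build false (M 0%N) [:: 0; 1; 2; 3; 4; 5; 6]%N) => //.
  + by rewrite lt0r M0_neq0 M0.
  + by case=> [|[|[|[|[|[|[|]]]]]]] //= _; lra.
  + by move=> out; apply: lamE; [lra | lra | exact: M7 | exact: out].
  + by case=> [|[|[|[|[|[|[|]]]]]]] // [|[|[|[|[|[|[|]]]]]]].
- have M00 : M 0%N = 0.
    apply/eqP/negPn/negP => M00; case: (few [:: 0; 1; 2; 3; 8; 9; 10; 11]%N) => //=.
    by rewrite M1 M2 M3 M9 M10 M11 M00 M80.
  have M7 : M 7%N = 0.
    apply/eqP/negPn/negP => M7; case: (few [:: 4; 5; 6; 7; 8; 9; 10; 11]%N) => //=.
    by rewrite M9 M10 M11 M5 M6 M80 M4_neq0 M7.
  (* Negating the seventh entry turns the classes 0 to 3 into 8 to 11 and fixes 4 to 6, where this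
     entry is 0. *)
  apply: (build true (M 8%N) [:: 8; 9; 10; 11; 4; 5; 6]%N) => //.
  + by rewrite lt0r M80 M0.
  + by case=> [|[|[|[|[|[|[|]]]]]]] //= _; lra.
  + by move=> out; apply: lamE; [lra | lra | exact: M7 | exact: out].
  + by case=> [|[|[|[|[|[|[|]]]]]]] // [|[|[|[|[|[|[|]]]]]]].
Qed.

(** The masses are proportional within the blocks 0 to 6 and 7 to 13. Both blocks together would
    need fourteen columns, so one of them vanishes. *)
Lemma classify_b (R : realFieldType) (lam lam' : 'I_7 -> R) (y : 'I_7 -> nat -> int) :
    (forall i, 0 < lam i) -> (forall j, 0 < lam' j) ->
    (forall i k : 'I_7,
      \sum_j lam' j * (y j i * y j k)%:~R = 16 * lam i * (i == k)%:R) ->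
    (forall j, exists2 eps : int, eps = 1 \/ eps = -1 &
       [seq eps * y j i | i <- iota 0 7] \in cols_b) ->
  matches lam lam' y cols_b (fun j => if (j < 6)%N then 1 else 2).
Proof.
move=> lam_gt0 lam'_gt0 gram /class_of_columns[cls clsP].
have := mass_ge0 lam'_gt0 cls; have few := @size_mass_neq0_all _ _ lam' cls.
have := solve_b (gram_eq_mass gram clsP).
have build := @matches_of_masses _ _ lam lam' y _ _ clsP.
move: (mass lam' cls) few build => M few build.
case=> [M_eq M6 M13 lam_eq] M0.
have M07 : 0 < M 0%N + M 7%N.
  by have := lam_eq 0%N isT; have := lam_gt0 (inord 0); rewrite /=; lra.
have lamE (p : R) : M 0%N + M 7%N = p ->
    forall j : 'I_7, lam j = p * (if (j < 6)%N then 1 else 2).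
  move=> <- j; rewrite -[in LHS](inord_val j) lam_eq //.
  by case: ifP => _; rewrite ?mulr1 // mulrC.
have [M70|M70] := eqVneq (M 7%N) 0.
- apply: (build _ false (M 0%N) [:: 0; 1; 2; 3; 4; 5; 6]%N) => //.
  + by lra.
  + by move=> j _; case: ifP.
  + move=> j lt_j7; case: (ltnP j 6) => j6.
      by rewrite mulr1 -(M_eq j j6).1; case: j j6 {lt_j7} => [|[|[|[|[|[|]]]]]].
    by have -> : j = 6%N by [lia]; rewrite /= M6 mulrC.
  + by move=> _; apply: lamE; lra.
  + by case=> [|[|[|[|[|[|[|]]]]]]] // [|[|[|[|[|[|[|]]]]]]].
- have M00 : M 0%N = 0.
    apply/eqP/negPn/negP => M00; case: (few (iota 0 14)) => //=.
    rewrite (M_eq 1%N isT).1 (M_eq 2%N isT).1 (M_eq 3%N isT).1 (M_eq 4%N isT).1.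
    rewrite (M_eq 5%N isT).1 (M_eq 1%N isT).2 (M_eq 2%N isT).2 (M_eq 3%N isT).2.
    by rewrite (M_eq 4%N isT).2 (M_eq 5%N isT).2 M6 M13 !mulf_neq0 ?M00 ?M70 ?pnatr_eq0.
  (* Class [7 + q] is class [q] with its seventh entry negated. *)
  apply: (build _ true (M 7%N) [:: 7; 8; 9; 10; 11; 12; 13]%N) => //.
  + by lra.
  + by move=> j _; case: ifP.
  + move=> j lt_j7; case: (ltnP j 6) => j6.
      by rewrite mulr1 -(M_eq j j6).2; case: j j6 {lt_j7} => [|[|[|[|[|[|]]]]]].
    by have -> : j = 6%N by [lia]; rewrite /= M13 mulrC.
  + by move=> _; apply: lamE; lra.
  + by case=> [|[|[|[|[|[|[|]]]]]]] // [|[|[|[|[|[|[|]]]]]]].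
Qed.

(** All eight masses equal the common value of [lam], hence are positive. *)
Lemma classify_c (R : realFieldType) (lam lam' : 'I_8 -> R) (y : 'I_8 -> nat -> int) :
    (forall i, 0 < lam i) -> (forall j, 0 < lam' j) ->
    (forall i k : 'I_8,
      \sum_j lam' j * (y j i * y j k)%:~R = 16 * lam i * (i == k)%:R) ->
    (forall j, exists2 eps : int, eps = 1 \/ eps = -1 &
       [seq eps * y j i | i <- iota 0 8] \in cols_c) ->
  matches lam lam' y cols_c (fun=> 1).
Proof.
move=> lam_gt0 lam'_gt0 gram /class_of_columns[cls clsP].
have M_eq := solve_c (gram_eq_mass gram clsP).
have lamE (j : 'I_8) : lam j = mass lam' cls 0%N.
  by rewrite -(M_eq j (ltn_ord j)).2 inord_val.
apply: (matches_of_masses clsP (flip := false) (p := mass lam' cls 0%N) (S := iota 0 8)) => //.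
- by rewrite -(lamE ord0).
- by move=> j lt_j8; rewrite nth_iota // mulr1 (M_eq j lt_j8).1.
- by move=> _ j; rewrite mulr1.
- by move=> i j _ lt_j8; rewrite nth_iota.
Qed.

(** * Scalar products and Watson's identity *)

Section Dot.
Variables (R : realType) (E : vectType R) (dot : {dot E for idfun}).
Implicit Types (u v x : E).

Lemma dotC u v : dot u v = dot v u.
Proof. by rewrite hermC /= expr0 mul1r. Qed.

Lemma dotDl u v x : dot (u + v) x = dot u x + dot v x.
Proof. exact: linearDl. Qed.
Lemma dotNl u x : dot (- u) x = - dot u x.
Proof. exact: linearNl. Qed.
Lemma dotZl a u x : dot (a *: u) x = a * dot u x.
Proof. exact: linearZl_LR. Qed.
Lemma dotDr u v x : dot x (u + v) = dot x u + dot x v.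
Proof. by rewrite dotC dotDl !(dotC _ x). Qed.
Lemma dotNr u x : dot x (- u) = - dot x u.
Proof. by rewrite dotC dotNl dotC. Qed.
Lemma dotZr a u x : dot x (a *: u) = a * dot x u.
Proof. by rewrite dotC dotZl dotC. Qed.
Lemma dot_sumr I (r : seq I) (P : pred I) (F : I -> E) x :
  dot x (\sum_(i <- r | P i) F i) = \sum_(i <- r | P i) dot x (F i).
Proof.
apply: (big_morph (dot x)) => [u v|]; first exact: dotDr.
by rewrite -(scale0r x) dotZr mul0r.
Qed.

Lemma dot_gt0 u : u != 0 -> 0 < dot u u.
Proof. exact: neq0_dnorm_gt0. Qed.

Definition dotE := (dotDl, dotDr, dotNl, dotNr, dotZl, dotZr).

Lemma dot_nondegenerate u : (forall v, dot v u = 0) -> u = 0.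
Proof.
move=> u0; apply/eqP; apply: contraT => /dot_gt0.
by rewrite u0 ltxx.
Qed.

(** The four vectors on the left are the vertices of a parallelogram with sides [v] and [x], whose
    centre is half of [u + u - v - x]. *)
Lemma rectangle_identity u v x :
  dot u u + dot (u - v) (u - v) + dot (u - x) (u - x)
    + dot (u - v - x) (u - v - x)
  = dot (u + u - v - x) (u + u - v - x) + dot v v + dot x x.
Proof. rewrite !dotE (dotC v u) (dotC x u) (dotC x v); ring. Qed.

(** Expand each norm: as |a| sg(a) = a, the cross terms add up to -2 (v, v), and the norms of the
    [x i] cancel. *)
Lemma watson_identity n (x : 'I_n -> E) (a : 'I_n -> R) :
  let v := \sum_i a i *: x i in
  \sum_i `|a i| * (dot (v - Num.sg (a i) *: x i) (v - Num.sg (a i) *: x i)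
                   - dot (x i) (x i))
  = (\sum_i `|a i| - 2) * dot v v.
Proof.
move=> v; have vv : dot v v = \sum_i a i * dot v (x i).
  by rewrite {2}/v dot_sumr; apply: eq_bigr => i _; rewrite dotZr.
have -> : \sum_i `|a i| * (dot (v - Num.sg (a i) *: x i) (v - Num.sg (a i) *: x i)
    - dot (x i) (x i)) = \sum_i (`|a i| * dot v v - 2 * (a i * dot v (x i))).
  apply: eq_bigr => i _; rewrite !dotE (dotC (x i) v).
  by have [->|_|_] := sgrP (a i); rewrite ?normr0; ring.
by rewrite sumrB -mulr_suml -mulr_sumr -vv mulrBl.
Qed.

(** The left side of Watson's identity is a sum of nonnegative terms; when the factor on the right
    vanishes, so does each term. *)
Lemma watson_bound n (x : 'I_n -> E) (a : 'I_n -> R) (m : R) :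
  let v := \sum_i a i *: x i in
  0 < dot v v -> (forall i, dot (x i) (x i) = m) ->
  (forall i, a i != 0 ->
     m <= dot (v - Num.sg (a i) *: x i) (v - Num.sg (a i) *: x i)) ->
  2 <= \sum_i `|a i| /\
  (\sum_i `|a i| = 2 -> forall i, a i != 0 ->
     dot (v - Num.sg (a i) *: x i) (v - Num.sg (a i) *: x i) = m).
Proof.
move=> v v_gt0 xm am; have := watson_identity x a; rewrite -/v => wat.
have F0 i : true -> 0 <= `|a i| *
    (dot (v - Num.sg (a i) *: x i) (v - Num.sg (a i) *: x i) - dot (x i) (x i)).
  move=> _; have [->|ai] := eqVneq (a i) 0; first by rewrite normr0 mul0r.
  by rewrite mulr_ge0 // xm subr_ge0 am.
split.
  have : 0 <= (\sum_i `|a i| - 2) * dot v v by rewrite -wat; exact: sumr_ge0.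
  by rewrite pmulr_lge0 // subr_ge0.
move=> a2 i ai.
have wat0 : (\sum_i `|a i| - 2) * dot v v = 0 by rewrite a2 subrr mul0r.
have /eqP := @psumr_eq0P _ _ _ _ F0 (etrans wat wat0) i isT.
by rewrite mulf_eq0 normr_eq0 (negPf ai) xm subr_eq0 => /eqP.
Qed.

End Dot.

(** * Integral spans and a normalized generator *)

Section IntSpan.
Variables (V : zmodType).

Lemma inIntSpan_tnth n (s : n.-tuple V) i : inIntSpan s (tnth s i).
Proof.
exists [ffun j => (j == i)%:Z]; rewrite (bigD1 i) //= big1 => [|j /negPf ji].
  by rewrite ffunE eqxx addr0 (tnth_nth 0).
by rewrite ffunE ji.
Qed.

Lemma inIntSpan0 n (s : n.-tuple V) : inIntSpan s 0.
Proof. by exists [ffun=> 0]; rewrite big1 // => i _; rewrite ffunE. Qed.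

Lemma inIntSpanD n (s : n.-tuple V) u v :
  inIntSpan s u -> inIntSpan s v -> inIntSpan s (u + v).
Proof.
case=> a -> [b ->]; exists [ffun i => a i + b i].
by rewrite -big_split; apply: eq_bigr => i _; rewrite ffunE mulrzDr.
Qed.

Lemma inIntSpanMz n (s : n.-tuple V) v (k : int) :
  inIntSpan s v -> inIntSpan s (v *~ k).
Proof.
case=> a ->; exists [ffun i => a i * k].
by rewrite mulrz_suml; apply: eq_bigr => i _; rewrite ffunE mulrzA.
Qed.

Lemma inIntSpanB n (s : n.-tuple V) u v :
  inIntSpan s u -> inIntSpan s v -> inIntSpan s (u - v).
Proof.
by move=> su sv; apply: inIntSpanD => //; rewrite -mulrN1z; apply: inIntSpanMz.
Qed.

Lemma inIntSpan_sub n p (s : n.-tuple V) (t : p.-tuple V) v :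
  (forall i, inIntSpan t (tnth s i)) -> inIntSpan s v -> inIntSpan t v.
Proof.
move=> st [a ->]; elim/big_rec: _ => [|i u _ tu]; first exact: inIntSpan0.
by apply: inIntSpanD => //; apply: inIntSpanMz; rewrite -tnth_nth.
Qed.

End IntSpan.

Lemma gen_over_shift (R : realType) (E : vectType R) p n (s : p.-tuple E)
    (t : n.-tuple E) (g h : E) :
  gen_over (inIntSpan s) (inIntSpan t) g -> inIntSpan t (g - h) ->
  gen_over (inIntSpan s) (inIntSpan t) h.
Proof.
move=> gen_g gh v; rewrite gen_g; split=> -[k vk]; exists k.
  have -> : v - h *~ k = (v - g *~ k) + (g - h) *~ k.
    by rewrite mulrzBl addrA subrK.
  by apply: inIntSpanD => //; apply: inIntSpanMz.
have -> : v - g *~ k = (v - h *~ k) - (g - h) *~ k.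
  by rewrite mulrzBl opprB addrA subrK.
by apply: inIntSpanB => //; apply: inIntSpanMz.
Qed.

Section Coordinates.
Variables (R : realType) (E : vectType R) (n : nat).

(* Integer vectors [y] stand for coordinates multiplied by 4. *)
Definition comb (x : 'I_n -> E) (y : 'I_n -> int) : E :=
  \sum_i ((y i)%:~R / 4) *: x i.

Lemma combD x y z : comb x (fun i => y i + z i) = comb x y + comb x z.
Proof.
rewrite /comb -big_split; apply: eq_bigr => i _ /=.
by rewrite rmorphD /= mulrDl scalerDl.
Qed.

Lemma combMz x y k : comb x (fun i => k * y i) = comb x y *~ k.
Proof.
rewrite mulrz_suml; apply: eq_bigr => i _.
by rewrite -[RHS]scaler_int scalerA rmorphM /= mulrA.
Qed.

Lemma comb4 x w : comb x (fun i => 4 * w i) = \sum_i x i *~ w i.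
Proof.
apply: eq_bigr => i _; rewrite rmorphM /= mulrAC mulfV ?mul1r ?scaler_int //.
by rewrite pnatr_eq0.
Qed.

Variables (e : n.-tuple E) (x : 'I_n -> E).
Hypothesis x_sign : forall i, x i = tnth e i \/ x i = - tnth e i.

Lemma sign_int i : exists2 s : int, s = 1 \/ s = -1 & x i = tnth e i *~ s.
Proof.
by case: (x_sign i) => ->; [exists 1 | exists (-1)]; auto.
Qed.

Lemma span_signs v : inIntSpan e v <-> exists w, v = comb x (fun i => 4 * w i).
Proof.
have /fin_all_exists2[s s1 sE] := sign_int.
split=> [[a ->]|[w ->]].
  exists (fun i => s i * a i); rewrite comb4; apply: eq_bigr => i _.
  rewrite sE (tnth_nth 0) -mulrzA mulrA.
  by case: (s1 i) => ->; rewrite ?mulrNN !mul1r.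
exists [ffun i => s i * w i]; rewrite comb4; apply: eq_bigr => i _.
by rewrite ffunE sE (tnth_nth 0) mulrzA.
Qed.

Hypothesis free_e : free e.

Lemma comb_free (a : 'I_n -> R) : \sum_i a i *: x i = 0 -> forall i, a i = 0.
Proof.
have /fin_all_exists2[s s1 sE] := sign_int.
move=> ax0 i.
have ae0 : \sum_j (a j * (s j)%:~R) *: e`_j = 0.
  by rewrite -[RHS]ax0; apply: eq_bigr => j _; rewrite sE (tnth_nth 0) -scalerA scaler_int.
have /freeP/(_ _ ae0 i)/eqP := free_e.
by rewrite mulf_eq0 intr_eq0; case: (s1 i) => ->; rewrite orbF => /eqP.
Qed.

Lemma comb_inj y z : comb x y = comb x z -> y =1 z.
Proof.
move=> /eqP; rewrite -subr_eq0 /comb -sumrB => /eqP yz i.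
have /comb_free/(_ i)/eqP : \sum_i ((y i)%:~R / 4 - (z i)%:~R / 4) *: x i = 0.
  by rewrite -[RHS]yz; apply: eq_bigr => j _; rewrite scalerBl.
by rewrite subr_eq0 (inj_eq (mulIf _)) ?invr_eq0 ?pnatr_eq0 // eqr_int => /eqP.
Qed.

End Coordinates.

(** The triple holds a sign, a residue and a quotient; the residue 3 is written as -1. *)
Lemma signed_residue (z : int) : exists u : int * nat * int,
  [/\ u.1.1 = 1 \/ u.1.1 = -1, (u.1.2 <= 2)%N & z = u.1.1 * u.1.2%:Z + 4 * u.2].
Proof.
have [q [zE|[zE|[zE|zE]]]] : exists q, z = 4 * q \/ z = 4 * q + 1 \/
    z = 4 * q + 2 \/ z = 4 * q + 3 by exists (z %/ 4)%Z; lia.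
- by exists (1, 0%N, q); split=> /=; [left| |lia].
- by exists (1, 1%N, q); split=> /=; [left| |lia].
- by exists (1, 2%N, q); split=> /=; [left| |lia].
- by exists (-1, 1%N, q + 1); split=> /=; [right| |lia].
Qed.

(** Four times a generator is an integral combination of the [e]. Changing signs and subtracting
    vectors of the span bring its coefficients to 0, 1 or 2. *)
Lemma quarter_generator (R : realType) (E : vectType R) (p n : nat)
    (s : p.-tuple E) (e : n.-tuple E) :
    cyclic_quotient (inIntSpan s) (inIntSpan e) 4 ->
  exists (x : 'I_n -> E) (c : 'I_n -> nat),
    [/\ forall i, x i = tnth e i \/ x i = - tnth e i, forall i, (c i <= 2)%N,
        gen_over (inIntSpan s) (inIntSpan e) (comb x (fun i => (c i)%:Z)) &
        exists i, c i = 1%N].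
Proof.
case=> g gen_g ord; have [z gz] : inIntSpan e (g *~ 4) by apply/ord.
have /fin_all_exists[u uP] := fun i => signed_residue (z i).
pose x i := tnth e i *~ (u i).1.1; pose c i := (u i).1.2.
have x_sign i : x i = tnth e i \/ x i = - tnth e i.
  by rewrite /x; case: (uP i) => -[->|->] _ _; [left | right].
have gh : inIntSpan e (g - comb x (fun i => (c i)%:Z)).
  exists [ffun i => (u i).2]; apply: (@scalerI _ _ (4%:~R)).
    by rewrite intr_eq0.
  rewrite !scaler_int mulrzBl gz -combMz comb4 mulrz_suml -sumrB.
  apply: eq_bigr => i _; rewrite ffunE /x (tnth_nth 0) -!mulrzA -mulrzBr.
  by have [_ _ ->] := uP i; congr (_ *~ _); rewrite /c; ring.
exists x, c; split=> //.
- by move=> i; have [] := uP i.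
- exact: gen_over_shift gh.
case: (pickP (fun i => c i == 1%N)) => [i /eqP ci|no1]; first by exists i.
(* Without a coefficient 1, twice the generator would lie in the span of the [e], against the order
   4. *)
have : (4%:Z %| 2)%Z; last by [].
apply/ord; rewrite -(subrK (comb x (fun i => (c i)%:Z)) g) mulrzDl.
apply: inIntSpanD; first exact: inIntSpanMz.
apply/(span_signs x_sign); exists (fun i => (c i == 2%N)%:Z); rewrite -combMz.
apply: eq_bigr => i _; congr (_%:~R / 4 *: _); have [_ + _] := uP i; rewrite -/(c i).
by move: (no1 i); case: (c i) => [|[|[|]]].
Qed.

(** * Watson's bounds on the numbers of ones and twos *)

Section MinimalVectors.
Variables (R : realType) (E : vectType R) (dot : {dot E for idfun}) (p n : nat).
Variables (s : p.-tuple E) (e : n.-tuple E) (x : 'I_n -> E) (c : 'I_n -> nat).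
Variable m : R.
Hypothesis free_e : free e.
Hypothesis x_sign : forall i, x i = tnth e i \/ x i = - tnth e i.
Hypothesis c_le2 : forall i, (c i <= 2)%N.
Hypothesis gen_s : gen_over (inIntSpan s) (inIntSpan e) (comb x (fun i => (c i)%:Z)).
Hypothesis m_gt0 : 0 < m.
Hypothesis norm_x : forall i, dot (x i) (x i) = m.
Hypothesis norm_min : forall v, inIntSpan s v -> v != 0 -> m <= dot v v.
Hypothesis has_one : exists i, c i = 1%N.
Implicit Types (y w : 'I_n -> int) (k : int).

Local Notation norm v := (dot v v).

Definition in_coset y : Prop := exists k w, forall i, y i = k * (c i)%:Z + 4 * w i.

Lemma comb_ext y z : y =1 z -> comb x y = comb x z.
Proof. by move=> yz; apply: eq_bigr => i _; rewrite yz. Qed.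

Lemma spanP v : inIntSpan s v <-> exists2 y, in_coset y & v = comb x y.
Proof.
rewrite gen_s; split=> [[k /(span_signs x_sign)[w vE]]|[y [k [w yE]] ->]].
  exists (fun i => k * (c i)%:Z + 4 * w i); first by exists k, w.
  by rewrite combD combMz -vE addrC subrK.
exists k; apply/(span_signs x_sign); exists w.
by rewrite (comb_ext yE) combD combMz addrAC subrr add0r.
Qed.

Lemma comb_neq0 y i : y i != 0 -> comb x y != 0.
Proof.
apply: contra_neq => y0; apply: (comb_inj x_sign free_e (y := y) (z := fun=> 0)).
by rewrite y0 /comb big1 // => j _; rewrite mul0r scale0r.
Qed.

Lemma norm_comb_ge y i : in_coset y -> y i != 0 -> m <= norm (comb x y).
Proof.
move=> yc yi; apply: norm_min; last exact: comb_neq0 yi.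
by apply/spanP; exists y.
Qed.

Definition move_by (i : 'I_n) (a : int) y j : int := y j + 4 * (a * (j == i)%:Z).

Lemma comb_move i a y : comb x (move_by i a y) = comb x y + a%:~R *: x i.
Proof.
rewrite /move_by combD comb4; congr (_ + _).
rewrite (bigD1 i) //= eqxx mulr1 big1 ?addr0 ?scaler_int // => j /negPf ->.
by rewrite mulr0.
Qed.

Lemma in_coset_move i a y : in_coset y -> in_coset (move_by i a y).
Proof.
case=> k [w yE]; exists k, (fun j => w j + a * (j == i)%:Z) => j.
by rewrite /move_by yE mulrDr addrA.
Qed.

(** The bound 8 is four times that of [watson_bound]. Excluding entries of absolute value 4 keeps
    the shifted vectors nonzero, so that their norms are at least [m]. *)
Lemma watson_comb y : in_coset y -> (exists i, y i != 0) -> (forall i, `|y i| != 4) ->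
  8 <= \sum_i `|y i| /\
  (\sum_i `|y i| = 8 -> forall i, y i != 0 ->
     norm (comb x (move_by i (- Num.sg (y i)) y)) = m).
Proof.
move=> yc [i0 yi0] y4.
pose a i : R := (y i)%:~R / 4.
have sum_a : \sum_i `|a i| = (\sum_i `|y i|)%:~R / 4.
  rewrite rmorph_sum mulr_suml; apply: eq_bigr => i _.
  by rewrite normrM -intr_norm normfV [`|4|]ger0_norm.
have sg_a i : Num.sg (a i) = (Num.sg (y i))%:~R.
  by rewrite intr_sg sgrM sgrV (@gtr0_sg _ 4) ?mulr1.
have move_a i : comb x (move_by i (- Num.sg (y i)) y) = comb x y - Num.sg (a i) *: x i.
  by rewrite comb_move rmorphN scaleNr sg_a.
have a0 i : (a i != 0) = (y i != 0).
  by rewrite mulf_eq0 invr_eq0 pnatr_eq0 orbF intr_eq0.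
have [||ge2 eq2] := @watson_bound _ _ dot n x a m _ norm_x.
- by apply: lt_le_trans m_gt0 _; apply: norm_comb_ge yi0.
- move=> i; rewrite a0 => yi; rewrite -/(comb x y) -move_a.
  apply: (@norm_comb_ge _ i); first exact: in_coset_move.
  by rewrite /move_by eqxx; move: (y4 i) yi; lia.
split.
  by rewrite -(ler_int R); move: ge2; rewrite sum_a; lra.
move=> y8 i yi; rewrite move_a; apply: eq2; last by rewrite a0.
by rewrite sum_a y8; lra.
Qed.

(** The coordinates, times 4, of half the sum of the [x i] with [c i = 1]; this is f in relation
    (a). *)
Definition half_ones (i : 'I_n) : int := 2 * (c i == 1%N)%:Z.

Lemma half_ones_coset : in_coset half_ones.
Proof.
exists 2, (fun i => - (c i == 2%N)%:Z) => i; rewrite /half_ones.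
by case: (c i) (c_le2 i) => [|[|[|]]].
Qed.

Lemma sum_half_ones : \sum_i `|half_ones i| = 2 * (ones c)%:Z.
Proof.
rewrite /ones PoszS mulr_sumr; apply: eq_bigr => i _.
by rewrite /half_ones; case: (c i == 1%N).
Qed.

Lemma half_ones_neq0 : exists i, half_ones i != 0.
Proof. by have [i ci] := has_one; exists i; rewrite /half_ones ci. Qed.

Lemma ones_ge4 : (4 <= ones c)%N.
Proof.
have [|+ _] := watson_comb half_ones_coset half_ones_neq0.
  by move=> i; rewrite /half_ones; case: (c i == 1%N).
by rewrite sum_half_ones; lia.
Qed.

(** Watson's bound at the generator itself. *)
Lemma ones_twos_ge8 : (8 <= ones c + (twos c).*2)%N.
Proof.
have [|||+ _] := @watson_comb (fun i => (c i)%:Z).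
- by exists 1, (fun=> 0) => i; rewrite mul1r mulr0 addr0.
- by have [i ci] := has_one; exists i; rewrite ci.
- by move=> i; case: (c i) (c_le2 i) => [|[|[|]]].
have -> : \sum_i `|(c i)%:Z| = (ones c)%:Z + 2 * (twos c)%:Z.
  rewrite /ones /twos !PoszS mulr_sumr -big_split; apply: eq_bigr => i _ /=.
  by case: (c i) (c_le2 i) => [|[|[|]]].
by lia.
Qed.

(** Four ones give equality in Watson's bound, so subtracting [x i0] from the half sum yields a
    vector of norm [m]. Its coordinates have the same absolute values, so equality holds there too,
    and the step at [i0] leads back to the half sum. *)
Lemma norm_half_ones : ones c = 4%N -> norm (comb x half_ones) = m.
Proof.
move=> m4; have [i0 ci0] := has_one.
have [|_ /(_ _ i0)] := watson_comb half_ones_coset half_ones_neq0.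
  by move=> i; rewrite /half_ones; case: (c i == 1%N).
rewrite sum_half_ones m4 => /(_ erefl); rewrite {1 2}/half_ones ci0 => /(_ isT).
set y := move_by _ _ _ => Ny.
have yE i : y i = half_ones i - 4 * (i == i0)%:Z.
  by rewrite /y /move_by /half_ones; lia.
have absy i : `|y i| = `|half_ones i|.
  by rewrite yE /half_ones; have [->|_] := eqVneq i i0; rewrite ?ci0 ?mulr0 ?subr0.
have [||i|_ /(_ _ i0)] := @watson_comb y.
- exact: in_coset_move half_ones_coset.
- by exists i0; rewrite yE /half_ones ci0 !eqxx.
- by rewrite absy /half_ones; case: (c i == 1%N).
under eq_bigr do rewrite absy.
rewrite sum_half_ones m4 => /(_ erefl); rewrite yE {1}/half_ones ci0 !eqxx => /(_ isT) <-.
congr (dot _ _); apply: comb_ext => i;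
  by rewrite /move_by !yE /half_ones ci0 !eqxx; case: (i == i0); lia.
Qed.

(** Take [rectangle_identity] at the generator with the two [x i] having [c i = 2]. The left side is
    at least 4 m; on the right stand the half sum and two vectors [x i], in all 3 m. *)
Lemma not_ones4_twos2 : ones c = 4%N -> twos c <> 2%N.
Proof.
move=> m4 m2; have [i1 ci1] : exists i, c i = 2%N.
  by apply: sum_eq_gt0; rewrite -/(twos c) m2.
have rest : (\sum_(i | i != i1) (c i == 2%N) = 1)%N.
  by move: m2; rewrite /twos (bigD1 i1) //= ci1 add1n => -[].
have [i2 /andP[i21 /eqP ci2]] : exists i, (i != i1) && (c i == 2%N).
  apply/existsP; apply: contraT; rewrite negb_exists => /forallP no.
  by move: rest; rewrite big1 // => i ii1; have := no i; rewrite ii1 /= => /negPf ->.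
have only i : i != i1 -> i != i2 -> c i != 2%N.
  move=> ii1 ii2; move: rest; rewrite (bigD1 i2) //= ci2 add1n => -[] /eqP.
  rewrite sum_nat_eq0 => /forallP/(_ i); rewrite ii1 ii2 /=.
  by case: (c i == 2%N).
have cc : in_coset (fun i => (c i)%:Z).
  by exists 1, (fun=> 0) => i; rewrite mul1r mulr0 addr0.
have [i0 ci0] := has_one.
have i01 : (i0 == i1) = false by apply/eqP => ii; move: ci0; rewrite ii ci1.
have i02 : (i0 == i2) = false by apply/eqP => ii; move: ci0; rewrite ii ci2.
have ge1 : m <= norm (comb x (fun i => (c i)%:Z)).
  by apply: (norm_comb_ge (i := i0)) => //; rewrite ci0.
have := rectangle_identity dot (comb x (fun i => (c i)%:Z)) (x i1) (x i2).
rewrite !norm_x.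
have -> : comb x (fun i => (c i)%:Z) + comb x (fun i => (c i)%:Z) - x i1 - x i2
    = comb x half_ones.
  rewrite -combD -[x i1]scale1r -[x i2]scale1r -!scaleNr.
  rewrite -(comb_move i1 (-1)) -(comb_move i2 (-1)); apply: comb_ext => i.
  rewrite /move_by /half_ones; have [->|ii1] := eqVneq i i1.
    by rewrite ci1 eq_sym (negPf i21).
  have [->|ii2] := eqVneq i i2; first by rewrite ci2.
  by have := only i ii1 ii2; case: (c i) (c_le2 i) => [|[|[|]]].
rewrite norm_half_ones //.
(* The coordinate at [i0] keeps the value 1, so these vectors are nonzero. *)
have ge a b : m <= norm (comb x (fun i => (c i)%:Z) + a%:~R *: x i1 + b%:~R *: x i2).
  rewrite -comb_move -comb_move; apply: (norm_comb_ge (i := i0)).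
    by do 2! apply: in_coset_move.
  by rewrite /move_by i01 i02 ci0; lia.
have := ge (-1) 0; have := ge 0 (-1); have := ge (-1) (-1).
rewrite !scaleN1r !scale0r !addr0; move: ge1 m_gt0; lra.
Qed.

End MinimalVectors.

(** * The perfection relation in coordinates *)

Lemma sum_sqr_le1 n (w : 'I_n -> int) : \sum_i w i ^+ 2 <= 1 ->
  (forall i, w i = 0) \/
  exists i, (w i = 1 \/ w i = -1) /\ forall j, j != i -> w j = 0.
Proof.
move=> w1; case: (pickP (fun i => w i != 0)) => [i wi|w0]; last first.
  by left=> i; apply/eqP/negPn; rewrite w0.
right; exists i; move: w1; rewrite (bigD1 i) //= -lerBrDl => w1.
have sq0 j : j != i -> 0 <= w j ^+ 2 by rewrite sqr_ge0.
have rest0 : 0 <= \sum_(j | j != i) w j ^+ 2 by apply: sumr_ge0.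
have wi1 : 1 <= w i ^+ 2 by rewrite -gtz0_ge1 exprn_even_gt0.
split; first by apply: sqr_cases; rewrite expr1n; move: (le_trans rest0 w1); lia.
have rest : \sum_(j | j != i) w j ^+ 2 = 0.
  by apply/eqP; rewrite eq_le rest0 andbT (le_trans w1) // subr_le0.
by move=> j ji; have /eqP := psumr_eq0P sq0 rest ji; rewrite sqrf_eq0 => /eqP.
Qed.

Section Relation.
Variables (R : realType) (E : vectType R) (dot : {dot E for idfun}) (n : nat).
Variables (e e' : n.-tuple E) (x : 'I_n -> E) (y : 'I_n -> 'I_n -> int).
Variables (lam lam' : 'I_n -> R) (m : R).
Hypothesis free_e : free e.
Hypothesis x_sign : forall i, x i = tnth e i \/ x i = - tnth e i.
Hypothesis m_gt0 : 0 < m.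
Hypothesis norm_x : forall i, dot (x i) (x i) = m.
Hypothesis norm_e' : forall j, dot (tnth e' j) (tnth e' j) = m.
Hypothesis e'E : forall j, tnth e' j = comb x (y j).

Lemma proj_opp u : proj dot (- u) = proj dot u.
Proof.
apply/lfunP => v; rewrite !lfunE /= /proj_fun dotNr dotNl dotNr opprK.
by rewrite scalerN mulNr scaleNr opprK.
Qed.

Hypothesis rel : \sum_i lam i *: proj dot (tnth e i)
               = \sum_j lam' j *: proj dot (tnth e' j).

(** Evaluate the relation at [v] and compare the coefficients of [x i]. Both sides are scalar
    products with [v], divided by the common norm [m], so nondegeneracy removes [v]. *)
Lemma relation_coord i :
  lam i *: x i = \sum_j (lam' j * ((y j i)%:~R / 4)) *: tnth e' j.
Proof.
apply/eqP; rewrite -subr_eq0; apply/eqP; apply: (dot_nondegenerate (dot := dot)) => v.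
have /lfunP/(_ v) := rel; rewrite !sum_lfunE.
have -> : \sum_k (lam k *: proj dot (tnth e k)) v
        = \sum_k (lam k * (dot v (x k) / m)) *: x k.
  apply: eq_bigr => k _; rewrite scale_lfunE.
  have -> : proj dot (tnth e k) = proj dot (x k).
    by case: (x_sign k) => ->; rewrite ?proj_opp.
  by rewrite lfunE /= /proj_fun norm_x scalerA.
have -> : \sum_j (lam' j *: proj dot (tnth e' j)) v
        = \sum_k (\sum_j lam' j * (dot v (tnth e' j) / m) * ((y j k)%:~R / 4)) *: x k.
  under [RHS]eq_bigr do rewrite scaler_suml.
  rewrite exchange_big; apply: eq_bigr => j _ /=.
  rewrite scale_lfunE lfunE /= /proj_fun norm_e' scalerA {2}e'E scaler_sumr.
  by apply: eq_bigr => k _; rewrite scalerA.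
move/eqP; rewrite -subr_eq0 -sumrB /=; under eq_bigr do rewrite -scalerBl.
move/eqP/(comb_free x_sign free_e)/(_ i)/eqP; rewrite subr_eq0 => /eqP eq_i.
rewrite dotDr dotNr dotZr dot_sumr; apply/eqP; rewrite subr_eq0; apply/eqP.
have m_neq0 : m != 0 by rewrite gt_eqF.
apply: (mulIf (invr_neq0 m_neq0)); rewrite -mulrA eq_i mulr_suml.
by apply: eq_bigr => j _; rewrite dotZr; ring.
Qed.

Lemma relation_gram i k :
  \sum_j lam' j * (y j i * y j k)%:~R = 16 * lam i * (i == k)%:R.
Proof.
have := relation_coord i; under eq_bigr do rewrite e'E scaler_sumr.
rewrite exchange_big /=; under eq_bigr do under eq_bigr do rewrite scalerA.
under eq_bigr do rewrite -scaler_suml.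
have -> : lam i *: x i = \sum_l (lam i * (i == l)%:R) *: x l.
  rewrite (bigD1 i) //= eqxx mulr1 big1 ?addr0 // => l li.
  by rewrite eq_sym (negPf li) mulr0 scale0r.
move/eqP; rewrite -subr_eq0 -sumrB /=; under eq_bigr do rewrite -scalerBl.
move/eqP/(comb_free x_sign free_e)/(_ k)/eqP; rewrite subr_eq0 => /eqP eq_k.
rewrite -mulrA eq_k mulr_sumr; apply: eq_bigr => j _.
by rewrite rmorphM /=; field.
Qed.

(** The equality of traces, obtained by pairing [relation_coord i] with [x i] and summing over
    [i]. *)
Lemma relation_mass : \sum_i lam i = \sum_j lam' j.
Proof.
have m_neq0 : m != 0 by rewrite gt_eqF.
apply: (mulIf m_neq0); rewrite !mulr_suml.
have -> : \sum_i lam i * m = \sum_i \sum_j lam' j * ((y j i)%:~R / 4) * dot (tnth e' j) (x i).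
  apply: eq_bigr => i _; rewrite -(norm_x i) -dotZl relation_coord dotC dot_sumr.
  by apply: eq_bigr => j _; rewrite dotZr dotC.
rewrite exchange_big; apply: eq_bigr => j _.
rewrite -(norm_e' j) {3}e'E dot_sumr mulr_sumr; apply: eq_bigr => i _.
by rewrite dotZr !mulrA.
Qed.

Hypothesis distinct : forall i j, proj dot (tnth e i) != proj dot (tnth e' j).

(** Otherwise e'_j would be zero or some [x i] up to sign, against [norm_e'] or [distinct]. *)
Lemma relation_nonunit j : nonunit (y j).
Proof.
move=> w yw; rewrite leNgt; apply/negP; rewrite ltzD1 => /sum_sqr_le1.
have e'w : tnth e' j = \sum_i x i *~ w i.
  by rewrite e'E -comb4; apply: eq_bigr => i _; rewrite yw.
case=> [w0|[i [wi w0]]].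
  have : dot (tnth e' j) (tnth e' j) = 0.
    rewrite e'w big1 => [|i _]; last by rewrite w0.
    by rewrite -(scale0r 0) dotZl mul0r.
  by rewrite norm_e' => m0; move: m_gt0; rewrite m0 ltxx.
move: e'w; rewrite (bigD1 i) //= big1 ?addr0 => [e'w|k ki]; last by rewrite w0.
case/negP: (distinct i j); apply/eqP.
by rewrite e'w; case: wi => ->; rewrite ?mulrN1z ?mulr1z ?proj_opp;
  case: (x_sign i) => ->; rewrite ?proj_opp.
Qed.

End Relation.

(** * Renumbering the basis so that the ones come first *)

Lemma perm_eq_ones_twos (s : seq nat) : (forall v, v \in s -> v = 1%N \/ v = 2%N) ->
  perm_eq s (nseq (count_mem 1%N s) 1%N ++ nseq (count_mem 2%N s) 2%N).
Proof.
move=> s12; apply/allP => v; rewrite mem_cat mem_cat => v_in.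
have v12 : v = 1%N \/ v = 2%N.
  by case/or3P: v_in => [/s12 //|/nseqP[-> _]|/nseqP[-> _]]; auto.
by rewrite /= count_cat !count_nseq; case: v12 => -> /=; rewrite ?mul1n ?mul0n ?addn0.
Qed.

Lemma sort_ones_twos n (c : 'I_n -> nat) :
    (forall i, (c i <= 2)%N) -> (forall i, c i <> 0%N) ->
  n = (ones c + twos c)%N /\
  exists s : 'S_n, forall i, c (s i) = if (i < ones c)%N then 1%N else 2%N.
Proof.
move=> c2 c0; pose t := [tuple c i | i < n].
have countE a : count_mem a t = (\sum_i (c i == a))%N.
  by rewrite -sum1_count big_map big_enum_cond /= big_mkcond; apply: eq_bigr => i _; case: eqP.
have := @perm_eq_ones_twos t; rewrite !countE -/(ones c) -/(twos c).
set u := _ ++ _ => perm_tu; have {}perm_tu : perm_eq t u.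
  apply: perm_tu => v /mapP[i _ ->].
  by move: (c2 i) (c0 i); case: (c i) => [|[|[|]]] //; auto.
have size_u : size u = n by rewrite -(perm_size perm_tu) size_tuple.
split; first by rewrite -{1}size_u size_cat !size_nseq.
pose u' : n.-tuple nat := Tuple (introT eqP size_u).
have /tuple_permP[s uE] : perm_eq u' t by rewrite perm_sym.
exists s => i; have := congr1 (fun v => nth 0%N v i) uE.
rewrite -[X in _ = X](tnth_nth 0%N [tuple tnth t (s j) | j < n]) !tnth_mktuple => <-.
rewrite /= nth_cat size_nseq !nth_nseq; case: (ltnP i (ones c)) => // i_ge.
by case: ifP => //; have := ltn_ord i; rewrite -[n in (_ < n)%N]size_u size_cat !size_nseq; lia.
Qed.

Lemma sum_onesE n (c : 'I_n.+1 -> nat) (s : 'S_n.+1) (f : 'I_n.+1 -> int) (k : nat) :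
    (forall i, c (s i) = if (i < k)%N then 1%N else 2%N) -> (k <= n.+1)%N ->
  sum_ones c f = \sum_(0 <= i < k) f (s (inord i)).
Proof.
move=> cs le_kn; rewrite /sum_ones (reindex_inj (@perm_inj _ s)) /=.
rewrite (big_nat_widen 0 k n.+1 xpredT) // big_mkord [RHS]big_mkcond /=.
apply: eq_bigr => i _; rewrite cs inord_val.
by case: (i < k)%N; rewrite ?mul1r ?mul0r.
Qed.

(** * Coordinates of the vectors in the three relations *)

Section Vectors.
Variables (R : realType) (E : vectType R).
Implicit Types (X : nat -> E).

Definition list_comb (n : nat) X (a : seq int) : E :=
  \sum_(i < n) ((a`_i)%:~R / 4) *: X i.+1.

Lemma quarter_vecE (m n : nat) X : (m <= n)%N ->
  quarter_vec m n X = \sum_(i < n) ((if (i < m)%N then 1 else 2) / 4) *: X i.+1.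
Proof.
move=> le_mn; rewrite /quarter_vec scalerDr scalerA !scaler_sumr.
rewrite -(big_mkord xpredT (fun i => ((if (i < m)%N then 1 else 2) / 4) *: X i.+1)).
rewrite !big_add1 /= [RHS](@big_cat_nat _ _ _ m) //=; congr (_ + _).
  by apply: eq_big_nat => i /andP[_ ->]; rewrite mul1r.
by apply: eq_big_nat => i /andP[le_mi _]; rewrite ltnNge le_mi /= mulrC.
Qed.

(** Coordinates are linear forms and separate vectors. This turns the vector identities below into
    identities of real numbers. *)
Lemma eq_scalar (u v : E) : (forall phi : {scalar E}, phi u = phi v) -> u = v.
Proof.
move=> uv; rewrite (coord_vbasis (memvf u)) (coord_vbasis (memvf v)).
by apply: eq_bigr => i _; rewrite (uv (coord (vbasis {:E}) i)).
Qed.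

Lemma vectors_aE X (j : nat) : (j < 7)%N ->
  vectors_a X j.+1 = list_comb 7 X (nth [::] cols_a j).
Proof.
move=> lt_j7; apply: eq_scalar => phi.
by case: j lt_j7 => [|[|[|[|[|[|[|]]]]]]] // _; rewrite /vectors_a /list_comb
  ?quarter_vecE // !big_ord_recr !big_ord0 /= !(linearD, linearN, linearZ, linear0) /=;
  field.
Qed.

Lemma vectors_bE X (j : nat) : (j < 7)%N ->
  vectors_bc 6 7 X j.+1 = list_comb 7 X (nth [::] cols_b j).
Proof.
move=> lt_j7; apply: eq_scalar => phi.
by case: j lt_j7 => [|[|[|[|[|[|[|]]]]]]] // _; rewrite /vectors_bc /list_comb
  quarter_vecE // !big_ord_recr !big_ord0 /= !(linearD, linearN, linearZ, linear0) /=;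
  field.
Qed.

Lemma vectors_cE X (j : nat) : (j < 8)%N ->
  vectors_bc 8 8 X j.+1 = list_comb 8 X (nth [::] cols_c j).
Proof.
move=> lt_j8; apply: eq_scalar => phi.
by case: j lt_j8 => [|[|[|[|[|[|[|[|]]]]]]]] // _; rewrite /vectors_bc /list_comb
  quarter_vecE // !big_ord_recr !big_ord0 /= !(linearD, linearN, linearZ, linear0) /=;
  field.
Qed.

End Vectors.

(** * From matching columns to the relation in [E] *)

Section Assembly.
Variables (R : realType) (E : vectType R) (p n : nat).
Local Notation N := n.+1.
Variables (sp : p.-tuple E) (e e' : N.-tuple E) (lam lam' : 'I_N -> R).
Variables (x : 'I_N -> E) (y : 'I_N -> 'I_N -> int) (c : 'I_N -> nat) (s : 'S_N).
Variable m1 : nat.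
Hypothesis x_sign : forall i, x i = tnth e i \/ x i = - tnth e i.
Hypothesis e'E : forall j, tnth e' j = comb x (y j).
Hypothesis c_sorted : forall i, c (s i) = if (i < m1)%N then 1%N else 2%N.
Hypothesis gen_sp : gen_over (inIntSpan sp) (inIntSpan e) (comb x (fun i => (c i)%:Z)).
Hypothesis le_m1N : (m1 <= N)%N.
Hypothesis le_m16 : n = 6%N -> (m1 <= 6)%N.

(** [X] is the sorted family [x], its seventh vector negated under [flip]. That vector has
    coefficient 2/4 in the generator, by [le_m16], so the negation changes the generator by a vector
    of the span of [e]. *)
Lemma relation_of_matches (C : seq (seq int)) (coef mu : nat -> R)
    (vec : (nat -> E) -> nat -> E) :
    (forall X j, (j < N)%N -> vec X j.+1 = list_comb N X (nth [::] C j)) ->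
    (forall j, mu j.+1 = coef j) ->
    matches (fun i => lam (s i)) lam' (fun j i => y j (s (inord i))) C coef ->
  exists X, gen_over (inIntSpan sp) (inIntSpan e) (quarter_vec m1 N X) /\
            same_relation e e' lam lam' X (vec X) mu mu.
Proof.
move=> vecE muE [flip [t [q [flip6 q_gt0 tP]]]].
pose Z i : E := x (s (inord i)).
(* [X] is indexed from 1, so [k = 7] is the coordinate of index 6. *)
pose X (k : nat) := if flip && (k == 7%N) then - Z k.-1 else Z k.-1.
have XE (i : 'I_N) : X i.+1 = if flip && (i == 6%N :> nat) then - x (s i) else x (s i).
  by rewrite /X /Z /= inord_val eqSS.
have vec_e' (j : 'I_N) : exists2 eps : int, eps = 1 \/ eps = -1 &
    vec X j.+1 = tnth e' (t j) *~ eps.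
  have [_ _ [eps epsE yE]] := tP j; exists eps => //.
  rewrite vecE // e'E /comb mulrz_suml (reindex_inj (@perm_inj _ s)) /=.
  apply: eq_bigr => i _; rewrite XE -scaler_int scalerA.
  have := yE i; rewrite inord_val => ->.
  case: ifP => _; last by congr (_ *: _); case: epsE => ->; rewrite rmorphM /=; ring.
  by rewrite scalerN -scaleNr; congr (_ *: _);
    case: epsE => ->; rewrite rmorphM rmorphN /=; ring.
exists X; split.
  apply: gen_over_shift gen_sp _; rewrite quarter_vecE //.
  rewrite /comb (reindex_inj (@perm_inj _ s)) -sumrB /=.
  have term (i : 'I_N) :
      ((c (s i))%:~R / 4) *: x (s i) - ((if (i < m1)%N then 1 else 2) / 4) *: X i.+1
      = if flip && (i == 6%N :> nat) then x (s i) else 0 :> E.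
    rewrite XE c_sorted; case: (boolP (flip && _)) => [/andP[fl /eqP i6]|_].
      have -> : (i < m1)%N = false.
        by apply/negbTE; rewrite -leqNgt i6; apply: le_m16; apply: flip6.
      by rewrite scalerN opprK -scalerDl -[RHS]scale1r; congr (_ *: _); field.
    by case: (i < m1)%N; rewrite subrr.
  under eq_bigr do rewrite term.
  elim/big_rec: _ => [|i u _ eu]; first exact: inIntSpan0.
  apply: inIntSpanD => //; case: ifP => _; last exact: inIntSpan0.
  have ei := inIntSpan_tnth e (s i).
  case: (x_sign (s i)) => -> //.
  by rewrite -[- _]add0r; apply: inIntSpanB => //; apply: inIntSpan0.
exists s, t, q; split=> // [i|j].
  have [lamE _ _] := tP i; rewrite muE; split=> //; rewrite XE.
  by case: ifP => _; case: (x_sign (s i)) => ->; rewrite ?opprK; auto.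
have [_ lamE _] := tP j; rewrite muE; split=> //.
by have [eps [->|->] ->] := vec_e' j; [left; rewrite mulr1z | right; rewrite mulrN1z].
Qed.

End Assembly.

Unset Implicit Arguments.

Theorem theorem6p4 (R : realType) (n : nat) (E : vectType R)
    (dot : {dot E for idfun}) (dimE : \dim {:E} = n)
    (L : E -> Prop) (latL : is_lattice L)
    (e e' : n.-tuple E)
    (min_e : forall i, minimal_vector dot L (tnth e i))
    (min_e' : forall j, minimal_vector dot L (tnth e' j))
    (rank_ee' : \dim <<e ++ e'>>%VS = n)
    (free_e : free e)
    (lam lam' : 'I_n -> R)
    (rel : perfection_relation dot e e' lam lam')
    (cyc4 : cyclic_quotient (inIntSpan (cat_tuple e e')) (inIntSpan e) 4) :
  (n = 7 \/ n = 8)%N /\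
  exists x : nat -> E,
    [\/ [/\ n = 7%N,
            gen_over (inIntSpan (cat_tuple e e')) (inIntSpan e)
              (quarter_vec 4 7 x)
          & same_relation e e' lam lam' x (vectors_a x)
              (@coef_one R) (@coef_one R)],
        [/\ n = 7%N,
            gen_over (inIntSpan (cat_tuple e e')) (inIntSpan e)
              (quarter_vec 6 7 x)
          & same_relation e e' lam lam' x (vectors_bc 6 7 x)
              (@coef_b R) (@coef_b R)]
      | [/\ n = 8%N,
            gen_over (inIntSpan (cat_tuple e e')) (inIntSpan e)
              (quarter_vec 8 8 x)
          & same_relation e e' lam lam' x (vectors_bc 8 8 x)
              (@coef_one R) (@coef_one R)]].
Proof.
case: rel => lam_gt0 lam'_gt0 rel distinct.
have [x [c [x_sign c2 gen [i0 ci0]]]] := quarter_generator cyc4.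
pose m := dot (tnth e i0) (tnth e i0).
have m_gt0 : 0 < m by apply: dot_gt0; have [] := min_e i0.
have same_norm u v : minimal_vector dot L u -> minimal_vector dot L v -> dot u u = dot v v.
  case=> Lu u0 umin [Lv v0 vmin].
  by apply/eqP; rewrite eq_le umin // vmin.
have norm_x i : dot (x i) (x i) = m.
  rewrite /m -(same_norm _ _ (min_e i) (min_e i0)).
  by case: (x_sign i) => ->; rewrite // dotNl dotNr opprK.
have norm_e' j : dot (tnth e' j) (tnth e' j) = m by exact: same_norm.
(* Lambda lies in [L], so the minimum of [L] bounds the norms of its nonzero vectors. *)
have ee'_L v : inIntSpan (cat_tuple e e') v -> L v.
  case: latL => b _ Lb /(inIntSpan_sub (t := b)) bv; apply/Lb/bv => i.
  apply/Lb; have := mem_tnth i (cat_tuple e e'); rewrite mem_cat.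
  by case/orP => /tnthP[j ->]; [have [] := min_e j | have [] := min_e' j].
have norm_min v : inIntSpan (cat_tuple e e') v -> v != 0 -> m <= dot v v.
  by move=> /ee'_L Lv v0; have [_ _] := min_e i0; apply.
have has_one : exists i, c i = 1%N by exists i0.
have e'P j : exists z, in_coset c z /\ tnth e' j = comb x z.
  have /(spanP x_sign gen)[z zc ->] : inIntSpan (cat_tuple e e') (tnth e' j).
    have -> : tnth e' j = tnth (cat_tuple e e') (rshift n j) by rewrite tnth_rshift.
    exact: inIntSpan_tnth.
  by exists z.
have /fin_all_exists[y yP] := e'P.
have e'E j : tnth e' j = comb x (y j) by case: (yP j).
have gram := relation_gram free_e x_sign m_gt0 norm_x norm_e' e'E rel.
have mass_eq := relation_mass free_e x_sign m_gt0 norm_x norm_e' e'E rel.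
have nonunit_y j : nonunit (y j).
  by move=> w yw; exact: relation_nonunit x_sign m_gt0 norm_e' e'E distinct j w yw.
have types := column_types lam_gt0 lam'_gt0 gram mass_eq c2 (fun j => (yP j).1) nonunit_y
  (ones_ge4 free_e x_sign c2 gen m_gt0 norm_x norm_min has_one)
  (ones_twos_ge8 free_e x_sign c2 gen m_gt0 norm_x norm_min has_one)
  (not_ones4_twos2 free_e x_sign c2 gen m_gt0 norm_x norm_min has_one).
(* The Gram equations persist under the renumbering [s], which puts the ones first as in the
   candidate lists. *)
have sorted c0 := sort_ones_twos c2 c0.
have gram_s (s : 'S_n) i k :
    \sum_j lam' j * (y j (s i) * y j (s k))%:~R = 16 * lam (s i) * (i == k)%:R.
  by rewrite gram (inj_eq perm_inj).
clear dimE rank_ee' rel distinct min_e min_e' cyc4.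
case: types => [[m4 m3 c0 cols]|[m6 m1 c0 cols]|[m8 m0 c0 cols]];
  have [nE [s c_sorted]] := sorted c0.
- have {}nE : n = 7%N by rewrite nE m4 m3.
  subst n; rewrite m4 in c_sorted; split; first by left.
  have [X [genX relX]] : exists X,
      gen_over (inIntSpan (cat_tuple e e')) (inIntSpan e) (quarter_vec 4 7 X) /\
      same_relation e e' lam lam' X (vectors_a X) (@coef_one R) (@coef_one R).
    apply: (relation_of_matches x_sign e'E c_sorted gen _ _
             (C := cols_a) (coef := fun=> 1)) => //; first exact: vectors_aE.
    apply: classify_a => // [i k|j]; first by rewrite -gram_s !inord_val.
    apply: cols_aP; case: (cols j) => [[eps epsE col]|col]; [left; exists eps => //|right].
      by move=> i lt_i7; have := col (s (inord i)); rewrite c_sorted inordK //;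
        case: (ltnP i 4) => _ [c1E c2E]; split=> // _; [apply: c1E | apply: c2E].
    by move=> i lt_i7; have := col (s (inord i)); rewrite c_sorted inordK //;
      case: (ltnP i 4) => _ [c1E c2E]; split=> // _; [apply: c1E | apply: c2E].
  by exists X; constructor 1.
- have {}nE : n = 7%N by rewrite nE m6 m1.
  subst n; rewrite m6 in c_sorted; split; first by left.
  have [X [genX relX]] : exists X,
      gen_over (inIntSpan (cat_tuple e e')) (inIntSpan e) (quarter_vec 6 7 X) /\
      same_relation e e' lam lam' X (vectors_bc 6 7 X) (@coef_b R) (@coef_b R).
    apply: (relation_of_matches x_sign e'E c_sorted gen _ _
             (C := cols_b) (coef := fun j => if (j < 6)%N then 1 else 2)) => //.
      exact: vectors_bE.
    apply: classify_b => // [i k|j]; first by rewrite -gram_s !inord_val.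
    have [eps [epsE sum_eps col]] := cols j; exists eps => //; apply: cols_bP.
      by move=> i lt_i7; have := col (s (inord i)); rewrite c_sorted inordK //;
        case: (ltnP i 6) => _ [c1E c2E]; split=> // _; [apply: c1E | apply: c2E].
    by rewrite -mulr_sumr -(sum_onesE (y j) c_sorted).
  by exists X; constructor 2.
- have {}nE : n = 8%N by rewrite nE m8 m0.
  subst n; rewrite m8 in c_sorted; split; first by right.
  have [X [genX relX]] : exists X,
      gen_over (inIntSpan (cat_tuple e e')) (inIntSpan e) (quarter_vec 8 8 X) /\
      same_relation e e' lam lam' X (vectors_bc 8 8 X) (@coef_one R) (@coef_one R).
    apply: (relation_of_matches x_sign e'E c_sorted gen _ _
             (C := cols_c) (coef := fun=> 1)) => //; first exact: vectors_cE.
    apply: classify_c => // [i k|j]; first by rewrite -gram_s !inord_val.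
    have [eps [epsE sum_eps col]] := cols j; exists eps => //; apply: cols_cP.
      by move=> i lt_i8; have := col (s (inord i)); rewrite c_sorted inordK // lt_i8;
        case=> c1E _; apply: c1E.
    by rewrite -mulr_sumr -(sum_onesE (y j) c_sorted) //; apply/eqP; rewrite -mem_seq1.
  by exists X; constructor 3.
Qed.
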